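(* Let $(\Omega,\Sigma,\mu)$ and $(\Delta,\Gamma,\nu)$ be $\sigma$-finite measure spaces, let $X_1(\mu),X_2(\mu)$ be saturated Banach function spaces over $\mu$ and $Y_1(\nu),Y_2(\nu)$ saturated Banach function spaces over $\nu$, and let $T\colon X_1(\mu)\to Y_1(\nu)$ and $S\colon X_2(\mu)\to Y_2(\nu)$ be nontrivial continuous linear operators. Assume that $Y_1(\nu)'$ has a Schauder basis $(\gamma_n)$ and $X_1(\mu)$ has a Schauder basis $(\beta_n)$. Assume that $Y_2^{Y_1''}$ is saturated and that $Y_2(\nu)$ or $Y_1(\nu)'$ is $\sigma$-order continuous. Given $h\in X_1^{X_2}$, the following are equivalent: (a) $T$ factors strongly through $S$ and $M_h$, i.e. there exists $g\in Y_2^{Y_1''}$ with $T(x)=g\,S(hx)$ for all $x\in X_1(\mu)$. (b) There exists $g\in Y_2^{Y_1''}$ such that $T(\beta_n)=g\,S(h\beta_n)$ for each $n\in\mathbb{N}$. (c) There exists $C>0$ such that $$\sum_{i=1}^n\sum_{j=1}^m r_{ij}\int T(\beta_j)\gamma_i\,d\nu\le C\Big\Vert\sum_{i=1}^n\sum_{j=1}^m r_{ij}S(h\beta_j)\gamma_i\Big\Vert_{Y_2\pi Y_1'}$$ for all $n,m\in\mathbb{N}$ and all real $(r_{ij})$ with $|r_{ij}|\le1$. Moreover, if $Y_2(\nu)\subset Y_1(\nu)''$ and the functions $(\gamma_n)$ have pairwise disjoint supports, then the condition (d) there exists $C>0$ such that $\sum_{j=1}^m r_j\int T(\beta_j)\gamma_n\,d\nu\le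 C\int\big|\sum_{j=1}^m r_jS(h\beta_j)\gamma_n\big|\,d\nu$ for all $n,m\in\mathbb{N}$ and all real $(r_j)$ with $|r_j|\le1$ implies (a)–(c). If, in addition to these, $Y_2^{Y_1''}=L^\infty(\nu)$, then (d) is equivalent to (a)–(c).
   Context: A Banach function space $X(\mu)$ is a Banach space $X(\mu)\subset L^0(\mu)$ (measurable functions mod a.e. equality) with norm such that $|f|\le|g|$ a.e., $g\in X(\mu)$ imply $f\in X(\mu)$ and $\Vert f\Vert_X\le\Vert g\Vert_X$; it is saturated if no set $A$ of positive measure satisfies $f\chi_A=0$ a.e. for all $f\in X(\mu)$; it is $\sigma$-order continuous if $f_n\downarrow 0$ a.e. with $f_n\in X(\mu)$ implies $\Vert f_n\Vert_X\downarrow0$. $X^Y=\{h: fh\in Y\ \forall f\in X\}$ with norm $\sup_{f\in B_X}\Vert hf\Vert_Y$; $X'=X^{L^1}$ (Köthe dual), $X''=(X')'$. The $\pi$-product $X\pi Y$ is the space of $h$ with $|h|\le\sum_n|f_ng_n|$ a.e. for some $f_n\in X$, $g_n\in Y$, $\sum_n\Vert f_n\Vert_X\Vert g_n\Vert_Y<\infty$, with norm the infimum of $\sum_n\Vert f_n\Vert_X\Vert g_n\Vert_Y$. *)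

(* Defs.v *)
From HB Require Import structures.
From mathcomp Require Import all_boot all_order all_algebra.
From mathcomp Require Import all_classical all_reals all_analysis.
Set Implicit Arguments. Unset Strict Implicit. Unset Printing Implicit Defensive.
Import Order.TTheory GRing.Theory Num.Theory.
Local Open Scope classical_set_scope.
Local Open Scope ring_scope.

(* Elements of L^0(mu) are represented by functions T -> R; everything below is
   invariant under a.e.-equality (the ideal property forces this). *)

Section BFS.
Context {d : measure_display} {T : measurableType d} {R : realType}.
Variable mu : {measure set T -> \bar R}.

Record BFS := {
  bfs_mem : (T -> R) -> Prop;
  bfs_norm : (T -> R) -> R;
  bfs_meas : forall f, bfs_mem f -> measurable_fun setT f;
  bfs_mem0 : bfs_mem (fun _ => 0);
  bfs_memD : forall f g, bfs_mem f -> bfs_mem g -> bfs_mem (fun x => f x + g x);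
  bfs_memZ : forall (a : R) f, bfs_mem f -> bfs_mem (fun x => a * f x);
  bfs_norm_ge0 : forall f, bfs_mem f -> 0 <= bfs_norm f;
  bfs_norm_eq0 : forall f, bfs_mem f ->
      (bfs_norm f = 0 <-> {ae mu, forall x, f x = 0});
  bfs_normD : forall f g, bfs_mem f -> bfs_mem g ->
      bfs_norm (fun x => f x + g x) <= bfs_norm f + bfs_norm g;
  bfs_normZ : forall (a : R) f, bfs_mem f ->
      bfs_norm (fun x => a * f x) = `|a| * bfs_norm f;
  bfs_ideal : forall f g : T -> R, measurable_fun setT f -> bfs_mem g ->
      {ae mu, forall x, `|f x| <= `|g x|} ->
      bfs_mem f /\ bfs_norm f <= bfs_norm g;
  bfs_complete : forall u : nat -> T -> R, (forall n, bfs_mem (u n)) ->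
      (forall e : R, 0 < e -> exists N, forall m n, (N <= m)%N -> (N <= n)%N ->
          bfs_norm (fun x => u m x - u n x) < e) ->
      exists f, bfs_mem f /\
        (fun n => bfs_norm (fun x => u n x - f x)) @ \oo --> 0 }.

Definition saturated (mem : (T -> R) -> Prop) : Prop :=
  ~ exists A : set T, [/\ measurable A, (0 < mu A)%E &
      forall f, mem f -> {ae mu, forall x, A x -> f x = 0}].

Definition sigma_oc (mem : (T -> R) -> Prop) (nrm : (T -> R) -> \bar R) : Prop :=
  forall u : nat -> T -> R, (forall n, mem (u n)) ->
    {ae mu, forall x, (forall n, u n.+1 x <= u n x) /\ (fun n => u n x) @ \oo --> 0} ->
    (fun n => nrm (u n)) @ \oo --> 0%E.

Definition schauder_basis (mem : (T -> R) -> Prop) (nrm : (T -> R) -> \bar R)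
    (b : nat -> T -> R) : Prop :=
  (forall n, mem (b n)) /\
  forall f, mem f -> exists! a : nat -> R,
    (fun N => nrm (fun x => f x - \sum_(k < N) a k * b k x)) @ \oo --> 0%E.

Definition mulsp_mem (memX memY : (T -> R) -> Prop) (h : T -> R) : Prop :=
  measurable_fun setT h /\ forall f, memX f -> memY (fun x => h x * f x).

Definition L1_mem (f : T -> R) : Prop := mu.-integrable setT (fun x => (f x)%:E).

Definition kdual_mem (memX : (T -> R) -> Prop) := mulsp_mem memX L1_mem.

Definition kdual_norm (memX : (T -> R) -> Prop) (nrmX : (T -> R) -> \bar R)
    (h : T -> R) : \bar R :=
  ereal_sup [set (\int[mu]_x (`|h x * f x|)%:E)%E
             | f in [set f | memX f /\ (nrmX f <= 1)%E]].

Definition pi_norm (memX : (T -> R) -> Prop) (nrmX : (T -> R) -> \bar R)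
    (memY : (T -> R) -> Prop) (nrmY : (T -> R) -> \bar R) (h : T -> R) : \bar R :=
  ereal_inf [set (\sum_(0 <= n <oo) (nrmX (fg.1 n) * nrmY (fg.2 n)))%E
     | fg in [set fg : (nat -> T -> R) * (nat -> T -> R) |
        [/\ forall n, memX (fg.1 n) /\ memY (fg.2 n),
            {ae mu, forall x, ((`|h x|)%:E <=
                 \sum_(0 <= n <oo) (`|fg.1 n x * fg.2 n x|)%:E)%E} &
            (\sum_(0 <= n <oo) (nrmX (fg.1 n) * nrmY (fg.2 n)) < +oo)%E]]].

Definition Linf_mem (f : T -> R) : Prop :=
  measurable_fun setT f /\ exists M : R, {ae mu, forall x, `|f x| <= M}.

End BFS.

Definition bfs_enorm {d} {T : measurableType d} {R : realType}
  {mu : {measure set T -> \bar R}} (X : BFS mu) (f : T -> R) : \bar R :=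
  (bfs_norm X f)%:E.

Definition bdd_linop {d1 d2} {O : measurableType d1} {D : measurableType d2}
  {R : realType} {mu : {measure set O -> \bar R}} {nu : {measure set D -> \bar R}}
  (X : BFS mu) (Y : BFS nu) (Op : (O -> R) -> (D -> R)) : Prop :=
  [/\ forall f, bfs_mem X f -> bfs_mem Y (Op f),
      forall f g, bfs_mem X f -> bfs_mem X g -> {ae mu, forall x, f x = g x} ->
        {ae nu, forall y, Op f y = Op g y},
      forall (a b : R) f g, bfs_mem X f -> bfs_mem X g ->
        {ae nu, forall y, Op (fun x => a * f x + b * g x) y = a * Op f y + b * Op g y} &
      exists K : R, forall f, bfs_mem X f -> bfs_norm Y (Op f) <= K * bfs_norm X f].

Definition nontrivial_op {d1 d2} {O : measurableType d1} {D : measurableType d2}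
  {R : realType} {mu : {measure set O -> \bar R}} (nu : {measure set D -> \bar R})
  (X : BFS mu) (Op : (O -> R) -> (D -> R)) : Prop :=
  exists f, bfs_mem X f /\ ~ {ae nu, forall y, Op f y = 0}.

(* Main.v *)
Require Import Defs.
From HB Require Import structures.
From mathcomp Require Import all_boot all_order all_algebra.
From mathcomp Require Import all_classical all_reals all_analysis.
From mathcomp Require Import measurable_realfun ring lra.
Set Implicit Arguments. Unset Strict Implicit. Unset Printing Implicit Defensive.
Import Order.TTheory GRing.Theory Num.Theory.
Import numFieldNormedType.Exports.
Local Open Scope classical_set_scope.
Local Open Scope ring_scope.

(** The implication from (c) to (a) is a duality argument.  By (c) the values
    [\int T(beta_j) gamma_i] are those of a linear functional on the products
    [S(h beta_j) gamma_i], dominated by a multiple of the norm of [Y2 pi Y1'];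
    Hahn-Banach extends it to the whole pi-product.  Since [Y2] or [Y1'] is
    sigma-order continuous, the extension is countably additive on the order
    ideal of [y0 z0], for weak units [y0] of [Y2] and [z0] of [Y1'], so
    Radon-Nikodym represents it as integration against some [g], which then
    multiplies [Y2] into [Y1''].  As the [gamma_i] span [Y1'], which is
    saturated, [T(beta_j) = g S(h beta_j)] a.e.  That the Koethe dual of a
    saturated space is saturated is obtained from the same two tools, applied to
    the infimal convolution of the norm with the L1 norm.  All boundedness
    statements (finiteness of the dual norm, continuity of multiplication
    operators) come from one gliding hump argument, which only uses that a
    sequence of summable norms is dominated by one element of the space. *)

(** * Hahn-Banach *)

(** Hahn-Banach is used in the Mazur-Orlicz form, which prescribes lower bounds on a cone instead of
    values on a subspace. In (c) the pairs made of a combination of products and the same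
    combination of integrals form such a cone, so it never has to be checked that coefficient arrays
    yielding the same function yield the same number; as the cone contains its opposites, the bounds
    become equalities. Order continuity of one factor is enough because the indicator that cuts a
    product down can be attached to either factor. For the saturation of the Koethe dual no order
    continuity is at hand, and the infimal convolution replaces it: lying below the L1 norm on a set
    of finite measure makes a functional countably additive, lying below the norm of the space puts
    its density in the dual. In (d) the inclusion of [Y2] in [Y1''] makes the constant 1 a
    multiplier, so that L1 norms are controlled by the pi-norm, and disjoint supports let the
    estimates for the single [gamma n] be added without loss. *)

Section HahnBanach.
Context {R : realType} {V : lmodType R} (Z : set V).
Hypotheses (Z0 : Z 0) (ZD : forall x y, Z x -> Z y -> Z (x + y))
  (ZZ : forall a x, Z x -> Z (a *: x)).

Definition sublinear (p : V -> R) :=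
  (forall x y, Z x -> Z y -> p (x + y) <= p x + p y) /\
  (forall a x, 0 <= a -> Z x -> p (a *: x) <= a * p x).

Let ZN x : Z x -> Z (- x). Proof. by rewrite -scaleN1r; exact: ZZ. Qed.

Let sublinear0 p : sublinear p -> p 0 = 0.
Proof.
move=> [pD pZ]; have := pD _ _ Z0 Z0; have := pZ 0 0 (lexx _) Z0.
rewrite addr0 scaler0 mul0r; lra.
Qed.

Let sublinearN p x : sublinear p -> Z x -> - p (- x) <= p x.
Proof.
move=> sp Zx; have := sp.1 _ _ Zx (ZN Zx).
rewrite subrr (sublinear0 sp); lra.
Qed.

(* The infimal convolution of a sublinear functional with a convex cone of
   lower bounds. *)
Let cone_inf (D : set (V * R)) (p : V -> R) z :=
  inf [set p (z + xt.1) - xt.2 | xt in D].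

(** Subadditivity of [p] together with [x.2 <= p x.1] on [D] bounds every competitor below by
    [- p (- z)], so the infimum is a genuine one. Used for the cone of prescribed bounds and then
    for a single ray, where it yields additivity. *)
Let cone_inf_sublinear (D : set (V * R)) p :
  sublinear p -> D (0, 0) ->
  (forall x y, D x -> D y -> D (x.1 + y.1, x.2 + y.2)) ->
  (forall a x, 0 <= a -> D x -> D (a *: x.1, a * x.2)) ->
  (forall x, D x -> Z x.1 /\ x.2 <= p x.1) ->
  sublinear (cone_inf D p) /\
  (forall z x, Z z -> D x -> cone_inf D p z <= p (z + x.1) - x.2).
Proof.
move=> sp D0 DD DZ Dp.
have lb z x : Z z -> D x -> - p (- z) <= p (z + x.1) - x.2.
  move=> Zz Dx; have [Zx xp] := Dp _ Dx.
  have := sp.1 _ _ (ZN Zz) (ZD Zz Zx); rewrite addKr; lra.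
have hlb z : Z z -> has_lbound [set p (z + xt.1) - xt.2 | xt in D].
  by move=> Zz; exists (- p (- z)) => _ [x Dx <-]; exact: lb.
have ub z x : Z z -> D x -> cone_inf D p z <= p (z + x.1) - x.2.
  by move=> Zz Dx; apply: ge_inf; [exact: hlb|exists x].
have ge c z : (forall x, D x -> c <= p (z + x.1) - x.2) -> c <= cone_inf D p z.
  move=> h; apply: lb_le_inf; first by exists (p (z + 0) - 0), (0, 0).
  by move=> _ [x Dx <-]; exact: h.
split => //; split.
  move=> x y Zx Zy; rewrite -lerBlDr; apply: (ge) => u Du.
  rewrite lerBlDl -lerBlDr; apply: (ge) => v Dv; rewrite lerBlDl.
  apply: le_trans (ub _ _ (ZD Zx Zy) (DD _ _ Du Dv)) _ => /=.
  have := sp.1 _ _ (ZD Zx (Dp _ Du).1) (ZD Zy (Dp _ Dv).1).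
  rewrite addrACA; lra.
move=> a x; rewrite le_eqVlt => /predU1P[<- Zx|a0 Zx].
  rewrite scale0r mul0r; apply: le_trans (ub _ _ Z0 D0) _.
  by rewrite /= addr0 subr0 (sublinear0 sp).
rewrite -ler_pdivrMl//; apply: (ge) => u Du; rewrite ler_pdivrMl//.
apply: le_trans (ub _ _ (ZZ a Zx) (DZ _ _ (ltW a0) Du)) _ => /=.
rewrite -scalerDr mulrBr lerD2r; apply: sp.2; first exact: ltW.
by apply: ZD => //; case: (Dp _ Du).
Qed.

(** Zorn's lemma for the reversed pointwise order, with pointwise infima as bounds of chains;
    [- p (- x)] keeps these infima finite. Only values on [Z] are compared, so the order is a mere
    preorder. *)
Let ex_minimal_sublinear p : sublinear p ->
  exists2 q, sublinear q /\ (forall x, Z x -> q x <= p x) &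
    forall r, sublinear r -> (forall x, Z x -> r x <= q x) ->
      forall x, Z x -> q x <= r x.
Proof.
move=> sp.
pose Q := {q | sublinear q /\ forall x, Z x -> q x <= p x}.
pose le_ (q r : Q) := `[< forall x, Z x -> sval r x <= sval q x >].
have p0 : Q by exists p; split.
have [||A Atot|[q [sq qp]] qmax] := @ZL_preorder Q p0 le_.
- by move=> t; apply/asboolP.
- move=> r s t /asboolP rs /asboolP st; apply/asboolP => x Zx.
  exact: le_trans (st x Zx) (rs x Zx).
- have [->|/set0P[a Aa]] := eqVneq A set0; first by exists p0.
  pose m x := inf [set sval s x | s in A].
  have hlb x : Z x -> has_lbound [set sval s x | s in A].
    move=> Zx; exists (- p (- x)) => _ [[s [ss sp']] As <-] /=.
    by apply: le_trans (sublinearN ss Zx); rewrite lerN2 sp'//; exact: ZN.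
  have ub s x : A s -> Z x -> m x <= sval s x.
    by move=> As Zx; apply: ge_inf; [exact: hlb|exists s].
  have ge c x : (forall s, A s -> c <= sval s x) -> c <= m x.
    move=> h; apply: lb_le_inf; first by exists (sval a x), a.
    by move=> _ [s As <-]; exact: h.
  have sm : sublinear m.
    split=> [x y Zx Zy|b x b0 Zx].
      rewrite -lerBlDr; apply: (ge) => s As.
      rewrite lerBlDl -lerBlDr; apply: (ge) => t At; rewrite lerBlDl.
      (* The two members of the chain, one per argument, are comparable, and the smaller one, [t],
         serves for both arguments. *)
      wlog st : x y s t As At Zx Zy / le_ s t.
        move=> H; have [st|ts] := Atot _ _ As At; first exact: H.
        by rewrite addrC [leRHS]addrC; exact: H.
      apply: le_trans (ub t _ At (ZD Zx Zy)) _.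
      apply: le_trans ((svalP t).1.1 _ _ Zx Zy) _.
      by rewrite lerD2r; move/asboolP : st; exact.
    have bs s : A s -> m (b *: x) <= b * sval s x.
      move=> As; apply: le_trans (ub s _ As (ZZ b Zx)) _.
      exact: (svalP s).1.2.
    move: b0; rewrite le_eqVlt => /predU1P[b0|b0].
      by have := bs _ Aa; rewrite -b0 !mul0r.
    by rewrite -ler_pdivrMl//; apply: (ge) => s As; rewrite ler_pdivrMl//; exact: bs.
  have mp x : Z x -> m x <= p x.
    by move=> Zx; apply: le_trans (ub _ _ Aa Zx) _; exact: (svalP a).2.
  exists (exist _ m (conj sm mp)) => s As; apply/asboolP => x Zx /=.
  exact: ub.
exists q => // r sr rq.
have rp x : Z x -> r x <= p x by move=> Zx; apply: le_trans (rq x Zx) (qp x Zx).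
have := qmax (exist _ r (conj sr rp)).
by move=> /(_ (introT (asboolP _) rq)) /asboolP.
Qed.

(** A minimal sublinear functional is linear. It is taken below [cone_inf D p] rather than below
    [p]: at [- x.1] this gives [F (- x.1) <= p 0 - x.2], which is the prescribed lower bound. *)
Theorem mazur_orlicz (D : set (V * R)) p :
  sublinear p -> D (0, 0) ->
  (forall x y, D x -> D y -> D (x.1 + y.1, x.2 + y.2)) ->
  (forall a x, 0 <= a -> D x -> D (a *: x.1, a * x.2)) ->
  (forall x, D x -> Z x.1 /\ x.2 <= p x.1) ->
  exists F : V -> R, [/\
    forall x y, Z x -> Z y -> F (x + y) = F x + F y,
    forall a x, Z x -> F (a *: x) = a * F x,
    forall x, Z x -> F x <= p x &
    forall x, D x -> x.2 <= F x.1].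
Proof.
move=> sp D0 DD DZ Dp.
have [sq qub] := cone_inf_sublinear sp D0 DD DZ Dp.
have [F [sF Fq] Fmin] := ex_minimal_sublinear sq.
have FD x y : Z x -> Z y -> F (x + y) = F x + F y.
  move=> Zx Zy; apply/eqP; rewrite eq_le (sF.1 _ _ Zx Zy)/=.
  (* The convolution of [F] with the ray through [(y, F y)] is sublinear and below [F]. Minimality
     then gives [F x <= F (x + y) - F y], the missing half of additivity. *)
  pose E : set (V * R) := [set (t *: y, t * F y) | t in [set t | 0 <= t]].
  have [||||sG Gub] := @cone_inf_sublinear E F sF.
  - by exists 0; rewrite //= scale0r mul0r.
  - move=> _ _ [s s0 <-] [t t0 <-]; exists (s + t); first exact: addr_ge0.
    by rewrite scalerDl mulrDl.
  - move=> a _ a0 [s s0 <-]; exists (a * s); first exact: mulr_ge0.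
    by rewrite scalerA mulrA.
  - move=> _ [t t0 <-] /=; split; first exact: ZZ.
    have [t00|t00] := eqVneq t 0.
      by rewrite t00 scale0r mul0r (sublinear0 sF).
    have tp : 0 < t by rewrite lt_neqAle eq_sym t00.
    rewrite -ler_pdivlMl//; apply: le_trans (sF.2 t^-1 _ _ _).
    + by rewrite scalerA mulVf// scale1r.
    + by rewrite invr_ge0.
    + exact: ZZ.
  have GF z : Z z -> cone_inf E F z <= F z.
    move=> Zz; apply: le_trans (Gub z (0, 0) Zz _) _ => /=.
      by exists 0; rewrite //= scale0r mul0r.
    by rewrite addr0 subr0.
  have Ey : E (y, F y) by exists 1; rewrite /= ?scale1r ?mul1r.
  rewrite -lerBrDr; apply: le_trans (Fmin _ sG GF _ Zx) (Gub x (y, F y) Zx Ey).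
have FN x : Z x -> F (- x) = - F x.
  by move=> Zx; have := FD _ _ Zx (ZN Zx); rewrite subrr (sublinear0 sF); lra.
have FZ a x : Z x -> F (a *: x) = a * F x.
  move=> Zx; apply/eqP; rewrite eq_le.
  wlog a0 : a x Zx / 0 <= a.
    move=> H; have [a0|/ltW a0] := leP 0 a; first exact: H.
    have := H (- a) (- x) (ZN Zx); rewrite oppr_ge0 scaleNr scalerN opprK.
    by rewrite (FN _ Zx) mulrNN; exact.
  rewrite sF.2//=.
  have := sF.2 a (- x) a0 (ZN Zx).
  by rewrite scalerN (FN _ Zx) (FN _ (ZZ a Zx)) mulrN lerN2.
exists F; split => //.
  move=> x Zx; apply: le_trans (Fq _ Zx) _.
  by apply: le_trans (qub x _ Zx D0) _; rewrite /= addr0 subr0.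
move=> x Dx; have [Zx _] := Dp _ Dx.
have := le_trans (Fq _ (ZN Zx)) (qub _ _ (ZN Zx) Dx).
by rewrite addNr (sublinear0 sp) (FN _ Zx) sub0r lerN2.
Qed.

End HahnBanach.

Definition sublinear_on {R : realType} {T : Type} (Z : set (T -> R))
    (p : (T -> R) -> R) :=
  (forall f g, Z f -> Z g -> p (fun x => f x + g x) <= p f + p g) /\
  (forall a f, 0 <= a -> Z f -> p (fun x => a * f x) <= a * p f).

Corollary mazur_orlicz_fun {R : realType} {T : Type} (Z : set (T -> R))
    (D : set ((T -> R) * R)) (p : (T -> R) -> R) :
  Z (fun=> 0) -> (forall f g, Z f -> Z g -> Z (fun x => f x + g x)) ->
  (forall a f, Z f -> Z (fun x => a * f x)) ->
  sublinear_on Z p -> D (fun=> 0, 0) ->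
  (forall f g, D f -> D g -> D (fun x => f.1 x + g.1 x, f.2 + g.2)) ->
  (forall a f, 0 <= a -> D f -> D (fun x => a * f.1 x, a * f.2)) ->
  (forall f, D f -> Z f.1 /\ f.2 <= p f.1) ->
  exists F : (T -> R) -> R, [/\
    forall f g, Z f -> Z g -> F (fun x => f x + g x) = F f + F g,
    forall a f, Z f -> F (fun x => a * f x) = a * F f,
    forall f, Z f -> F f <= p f &
    forall f, D f -> f.2 <= F f.1].
Proof.
move=> Z0 ZD ZZ sp D0 DD DZ Dp.
exact: (@mazur_orlicz R (T -> R) Z Z0 ZD ZZ D p sp D0 DD DZ Dp).
Qed.

(** * Ideal spaces *)

Section NullSequences.
Context {R : realType}.

Lemma cvg0_lt (u : nat -> R) (e : R) : u @ \oo --> (0 : R) -> 0 < e ->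
  exists N, forall n, (N <= n)%N -> `|u n| < e.
Proof.
move=> /cvgrPdist_lt /[apply] -[N _ HN]; exists N => n /HN /=.
by rewrite sub0r normrN.
Qed.

Lemma cvge0_lt (u : nat -> \bar R) (e : R) : u @ \oo --> 0%E -> 0 < e ->
  exists N, forall n, (N <= n)%N -> (u n < e%:E)%E.
Proof.
move=> /fine_cvgP[[N1 _ fu] /cvg0_lt /[apply] -[N2 HN]].
exists (maxn N1 N2) => n; rewrite geq_max => /andP[/fu /= un /HN].
by rewrite /= -{2}(fineK un) lte_fin; exact/le_lt_trans/ler_norm.
Qed.

Lemma cvg_half : (fun n => (2^-1 : R) ^+ n) @ \oo --> (0 : R).
Proof. by apply: cvg_expr; rewrite ger0_norm; lra. Qed.

End NullSequences.

Section IdealSpace.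
Context {d : measure_display} {T : measurableType d} {R : realType}.
Variable mu : {measure set T -> \bar R}.
Implicit Types (mem : (T -> R) -> Prop) (nrm : (T -> R) -> \bar R).

(* What Banach function spaces and their Koethe duals have in common; the
   last axiom is the form in which completeness is used. *)
Record ideal_space mem nrm : Prop := IdealSpace {
  il_meas : forall f, mem f -> measurable_fun setT f;
  il_mem0 : mem (fun=> 0);
  il_memD : forall f g, mem f -> mem g -> mem (fun x => f x + g x);
  il_memZ : forall (a : R) f, mem f -> mem (fun x => a * f x);
  il_fin : forall f, mem f -> nrm f \is a fin_num;
  il_ge0 : forall f, mem f -> (0 <= nrm f)%E;
  il_normD : forall f g, mem f -> mem g ->
    (nrm (fun x => (f x + g x)%R) <= nrm f + nrm g)%E;
  il_normZ : forall (a : R) f, mem f ->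
    nrm (fun x => a * f x) = (`|a|%:E * nrm f)%E;
  il_solid : forall f g : T -> R, measurable_fun setT f -> mem g ->
    {ae mu, forall x, `|f x| <= `|g x|} -> mem f /\ (nrm f <= nrm g)%E;
  il_dom : forall u : nat -> T -> R, (forall n, mem (u n)) ->
    (forall n, (nrm (u n) <= ((2^-1 : R) ^+ n)%:E)%E) ->
    exists2 F, mem F & forall n, {ae mu, forall x, `|u n x| <= F x} }.

Lemma measurable_normr (f : T -> R) :
  measurable_fun setT f -> measurable_fun setT (fun x => `|f x|).
Proof. by move=> mf; exact: measurableT_comp. Qed.

Lemma bfs_mem_norm (X : BFS mu) f : bfs_mem X f ->
  bfs_mem X (fun x => `|f x|) /\ bfs_norm X (fun x => `|f x|) <= bfs_norm X f.
Proof.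
move=> Xf; apply: (bfs_ideal (measurable_normr (bfs_meas Xf)) Xf).
by apply: aeW => x; rewrite normr_id.
Qed.

(** The partial sums of the [|u k|] form a Cauchy sequence, and their limit in norm is the
    dominating function. Norm convergence says nothing pointwise by itself; monotonicity of the
    partial sums supplies the a.e. inequality. *)
Lemma bfs_dom (X : BFS mu) (u : nat -> T -> R) : (forall n, bfs_mem X (u n)) ->
  (forall n, bfs_norm X (u n) <= (2^-1) ^+ n) ->
  exists2 F, bfs_mem X F & forall n, {ae mu, forall x, `|u n x| <= F x}.
Proof.
move=> Xu un; pose s N x : R := \sum_(k < N) `|u k x|.
have sS N : s N.+1 = fun x => s N x + `|u N x|.
  by apply/funext => x; rewrite /s big_ord_recr.
have Xs N : bfs_mem X (s N).
  elim: N => [|N IH].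
    rewrite (_ : s 0%N = fun=> 0); first exact: bfs_mem0.
    by apply/funext => x; rewrite /s big_ord0.
  by rewrite sS; apply: bfs_memD => //; case: (bfs_mem_norm (Xu N)).
have s_nd N k x : s N x <= s (N + k)%N x.
  by elim: k => [|k IH]; rewrite ?addn0// addnS sS (le_trans IH)// lerDl.
have XB f g : bfs_mem X f -> bfs_mem X g -> bfs_mem X (fun x => f x - g x).
  move=> Xf Xg; rewrite (_ : (fun _ => _) = fun x => f x + (-1) * g x).
    by apply: bfs_memD => //; exact: bfs_memZ.
  by apply/funext => x; rewrite mulN1r.
have sC N k : bfs_norm X (fun x => s (N + k)%N x - s N x) <=
    2 * (2^-1) ^+ N - 2 * (2^-1) ^+ (N + k).
  elim: k => [|k IH].
    rewrite addn0 subrr (_ : (fun _ => _) = fun=> 0).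
      rewrite le_eqVlt; apply/orP; left; apply/eqP.
      by apply/(bfs_norm_eq0 (bfs_mem0 X)); exact: aeW.
    by apply/funext => x; rewrite subrr.
  rewrite addnS sS.
  rewrite (_ : (fun _ => _) = fun x => (s (N + k)%N x - s N x) + `|u (N + k)%N x|).
    apply: le_trans (bfs_normD (XB _ _ (Xs _) (Xs _)) (bfs_mem_norm (Xu _)).1) _.
    have := le_trans (bfs_mem_norm (Xu (N + k)%N)).2 (un (N + k)%N).
    rewrite exprS; lra.
  by apply/funext => x; rewrite addrAC.
have sym m n : bfs_norm X (fun x => s m x - s n x) =
    bfs_norm X (fun x => s n x - s m x).
  rewrite (_ : (fun _ => _) = fun x => (-1) * (s n x - s m x)).
    by rewrite bfs_normZ ?normrN1 ?mul1r//; exact: XB.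
  by apply/funext => x; lra.
have [|F [XF sF]] := bfs_complete Xs.
  move=> e e0.
  have [|N HN] := @cvg0_lt R _ (e / 2) cvg_half; first lra.
  have {}HN : 2 * (2^-1) ^+ N < e.
    by have /= := HN N (leqnn _); rewrite ger0_norm ?exprn_ge0//; lra.
  exists N => m n Nm Nn.
  wlog mn : m n Nm Nn / (n <= m)%N.
    move=> H; have [mn|/ltnW nm] := leqP n m; first exact: H.
    by rewrite sym; exact: H.
  rewrite -(subnKC mn); apply: le_lt_trans (sC _ _) _.
  have h1 : (2^-1 : R) ^+ n <= 2^-1 ^+ N by rewrite ler_wiXn2l//; lra.
  have h2 : 0 <= (2^-1 : R) ^+ (n + (m - n)) by rewrite exprn_ge0//; lra.
  lra.
(* The positive part [w] is below [|s (n.+1 + k) - F|] for every [k], because the partial sums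
   increase. Its norm is therefore 0, and [s n.+1 <= F] a.e. *)
exists F => // n; pose w x := Num.max (s n.+1 x - F x) 0.
have mw : measurable_fun setT w.
  apply: measurable_maxr => //; apply: measurable_funB; apply: (bfs_meas (b := X)) => //; exact: Xs.
have wle k : bfs_mem X w /\
    bfs_norm X w <= bfs_norm X (fun x => s (n.+1 + k)%N x - F x).
  apply: bfs_ideal => //; first exact: XB.
  apply: aeW => x; rewrite /w; have := s_nd n.+1 k x => sk.
  rewrite ger0_norm ?le_max ?lexx ?orbT// ge_max normr_ge0 andbT.
  by apply: le_trans (ler_norm _); rewrite lerD2r.
have Xw := (wle 0%N).1.
have w0 : bfs_norm X w = 0.
  apply/eqP; rewrite eq_le bfs_norm_ge0// andbT leNgt; apply/negP => w0.
  have [N HN] := cvg0_lt sF w0.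
  have /= := HN (n.+1 + N)%N (leq_addl _ _).
  rewrite ger0_norm ?bfs_norm_ge0 ?ltNge ?(wle N).2//; exact: XB.
have := (bfs_norm_eq0 Xw).1 w0; apply: filterS => x wx.
have : s n.+1 x - F x <= w x by rewrite le_max lexx.
rewrite wx subr_le0; apply: le_trans; rewrite sS lerDr.
by apply: sumr_ge0.
Qed.

Lemma bfs_ideal_space (X : BFS mu) : ideal_space (bfs_mem X) (bfs_enorm X).
Proof.
split.
- exact: bfs_meas.
- exact: bfs_mem0.
- exact: bfs_memD.
- exact: bfs_memZ.
- by [].
- by move=> f Xf; rewrite lee_fin bfs_norm_ge0.
- by move=> f g Xf Xg; rewrite -EFinD lee_fin bfs_normD.
- by move=> a f Xf; rewrite /bfs_enorm bfs_normZ.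
- by move=> f g mf Xg fg; rewrite lee_fin; exact: bfs_ideal.
- by move=> u Xu un; apply: bfs_dom => // n; rewrite -lee_fin un.
Qed.

End IdealSpace.

(** * Boundedness, a.e. convergence and weak units in ideal spaces *)

Section IdealSpaceTheory.
Context {d : measure_display} {T : measurableType d} {R : realType}.
Variable mu : {measure set T -> \bar R}.
Implicit Types (mem : (T -> R) -> Prop) (nrm : (T -> R) -> \bar R).

Lemma le_measure_ae (A B : set T) : measurable A -> measurable B ->
  {ae mu, forall x, A x -> B x} -> (mu A <= mu B)%E.
Proof.
move=> mA mB [N [mN N0 AB]].
rewrite -(adde0 (mu B)) -N0; apply: le_trans (measureU2 _ mB mN).
apply: le_measure; rewrite ?inE//; first exact: measurableU.
move=> x Ax; have [Bx|Bx] := pselect (B x); first by left.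
by right; apply: AB => /= /(_ Ax).
Qed.

Lemma measurable_zeros (f : T -> R) : measurable_fun setT f ->
  measurable [set x | f x = 0].
Proof.
move=> mf; rewrite -[X in measurable X]setTI.
rewrite (_ : [set x | f x = 0] = f @^-1` [set 0])//.
exact: mf.
Qed.

Lemma halfX_gt0 n : 0 < (2^-1 : R) ^+ n.
Proof. by rewrite exprn_gt0// invr_gt0. Qed.

Lemma natr_le_2X n : n%:R <= (2 : R) ^+ n.
Proof. by rewrite -natrX ler_nat ltnW// ltn_expl. Qed.

Section One.
Variables (mem : (T -> R) -> Prop) (nrm : (T -> R) -> \bar R).
Hypothesis I : ideal_space mu mem nrm.

Lemma il_norm f : mem f ->
  mem (fun x => `|f x|) /\ (nrm (fun x => `|f x|%R) <= nrm f)%E.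
Proof.
move=> If; apply: (il_solid I (measurable_normr (il_meas I If)) If).
by apply: aeW => x; rewrite normr_id.
Qed.

Lemma il_memB f g : mem f -> mem g -> mem (fun x => f x - g x).
Proof.
move=> If Ig; rewrite (_ : (fun _ => _) = fun x => f x + (-1) * g x).
  by apply: (il_memD I) => //; exact: (il_memZ I).
by apply/funext => x; rewrite mulN1r.
Qed.

Lemma il_norm0 : nrm (fun=> 0) = 0%E.
Proof.
have := il_normZ I 0 (il_mem0 I); rewrite normr0 mul0e => <-.
by congr nrm; apply/funext => x; rewrite mulr0.
Qed.

(** Dividing by [1 + N n], which cannot vanish, brings any sequence into the scope of [il_dom]. The
    positive factors are harmless when only zero sets matter, as in the construction of weak
    units. *)
Lemma il_dom_scaled (u : nat -> T -> R) : (forall n, mem (u n)) ->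
  exists2 F, mem F &
    forall n, exists2 c, 0 < c & {ae mu, forall x, c * `|u n x| <= F x}.
Proof.
move=> Iu; pose N n := fine (nrm (u n)).
have N0 n : 0 <= N n by rewrite fine_ge0// (il_ge0 I).
pose c n := (2^-1) ^+ n / (1 + N n).
have c0 n : 0 < c n.
  by rewrite /c divr_gt0 ?halfX_gt0//; have := N0 n; lra.
have [n||F IF Fu] := @il_dom _ _ _ _ _ _ I (fun n x => c n * u n x).
- exact: (il_memZ I).
- move=> n; rewrite (il_normZ I)// -(fineK (il_fin I (Iu n))) -EFinM lee_fin.
  rewrite gtr0_norm// /c mulrAC ler_pdivrMr; last by have := N0 n; lra.
  by rewrite ler_pM2l ?halfX_gt0// lerDr.
exists F => // n; exists (c n) => //; apply: filterS (Fu n) => x.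
by rewrite normrM gtr0_norm.
Qed.

(* Gliding hump: if Phi were unbounded, then Phi (v n) = 2 ^+ n for suitable
   v n with nrm (v n) <= 2 ^- n, and these are dominated by a single function. *)
Lemma il_bounded (Phi : (T -> R) -> \bar R) :
  (forall f, mem f -> Phi f \is a fin_num) ->
  (forall f g, mem f -> mem g -> {ae mu, forall x, `|f x| <= `|g x|} ->
    (Phi f <= Phi g)%E) ->
  (forall a f, mem f -> Phi (fun x => a * f x) = (`|a|%:E * Phi f)%E) ->
  exists2 K : R, 0 < K & forall f, mem f -> (Phi f <= K%:E * nrm f)%E.
Proof.
move=> Pfin Ple PZ; apply: contrapT => /forall2NP noK.
(* The constant is the square of [2 ^+ n]: one factor is used up by normalising [Phi] to [2 ^+ n],
   the other leaves a norm of at most [2 ^- n]. *)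
have {}noK n : exists f, mem f /\ ((4 ^+ n)%:E * nrm f < Phi f)%E.
  have [|/existsNP[f /not_implyP[If /negP Pf]]] := noK (4 ^+ n).
    by case; rewrite exprn_gt0.
  by exists f; split => //; rewrite ltNge.
have [f fP] := choice noK.
have If n : mem (f n) := (fP n).1.
pose p n := fine (Phi (f n)); pose N n := fine (nrm (f n)).
have N0 n : 0 <= N n by rewrite fine_ge0// (il_ge0 I).
have pE n : Phi (f n) = (p n)%:E by rewrite /p fineK// Pfin.
have NE n : nrm (f n) = (N n)%:E by rewrite /N fineK// (il_fin I).
have Np n : 4 ^+ n * N n < p n.
  by have := (fP n).2; rewrite pE NE -EFinM lte_fin.
have p0 n : 0 < p n.
  by apply: le_lt_trans (Np n); rewrite mulr_ge0// exprn_ge0.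
pose c n : R := 2 ^+ n / p n.
have c0 n : 0 < c n by rewrite divr_gt0// exprn_gt0.
have [n||F IF Fu] := @il_dom _ _ _ _ _ _ I (fun n x => c n * f n x).
- exact: (il_memZ I).
- move=> n; rewrite (il_normZ I)// NE -EFinM lee_fin gtr0_norm//.
  rewrite /c mulrAC ler_pdivrMr// exprVn mulrC.
  rewrite -ler_pdivrMl ?invr_gt0 ?exprn_gt0// invrK.
  by rewrite mulrCA -exprMn (_ : 2 * 2 = 4) 1?mulrC ?ltW// -natrM.
have [m] : exists m : nat, fine (Phi F) < m%:R.
  by exists (Num.trunc (fine (Phi F))).+1; exact: truncnS_gt.
apply/negP; rewrite -leNgt; apply: le_trans (natr_le_2X m) _.
rewrite -lee_fin fineK ?Pfin//.
have <- : Phi (fun x => c m * f m x) = (2 ^+ m)%:E.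
  by rewrite PZ// pE -EFinM gtr0_norm// /c divfK// gt_eqF.
apply: Ple => //; first exact: (il_memZ I).
by apply: filterS (Fu m) => x /le_trans; apply; exact: ler_norm.
Qed.

(** The rate [4 ^- n] leaves room for a factor [2 ^+ n]: the functions [2 ^+ n * u n] still have a
    common dominating function [F], so [|u n| <= F / 2 ^+ n] a.e. *)
Lemma il_ae_cvg0 (u : nat -> T -> R) : (forall n, mem (u n)) ->
  (forall n, (nrm (u n) <= ((4^-1 : R) ^+ n)%:E)%E) ->
  {ae mu, forall x, (fun n => u n x) @ \oo --> (0 : R)}.
Proof.
move=> Iu un.
have [n||F IF Fu] := @il_dom _ _ _ _ _ _ I (fun n x => 2 ^+ n * u n x).
- exact: (il_memZ I).
- move=> n; rewrite (il_normZ I)//.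
  have := un n; rewrite -(fineK (il_fin I (Iu n))) -EFinM !lee_fin.
  rewrite ger0_norm ?exprn_ge0// => h.
  rewrite exprVn -ler_pdivlMl ?exprn_gt0//; apply: le_trans h _.
  by rewrite -invfM -exprMn exprVn (_ : 2 * 2 = 4)// -natrM.
have {Fu} := ae_foralln Fu; apply: filterS => x Fx.
have h n : `|u n x| <= F x * (2^-1) ^+ n.
  have := Fx n; rewrite normrM ger0_norm ?exprn_ge0//.
  by rewrite exprVn ler_pdivlMr ?exprn_gt0// mulrC.
apply/cvgr0Pnorm_lt => e e0.
have : (fun n => F x * (2^-1) ^+ n) @ \oo --> F x * (0 : R).
  exact: cvgMr cvg_half.
rewrite mulr0 => /cvg0_lt /(_ e0)[N HN]; exists N => // n /= /HN.
by apply: le_lt_trans; exact: le_trans (h n) (ler_norm _).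
Qed.

(** An exhaustion argument. The measure of the zero set inside [D] is minimised over the space, and
    a minimising sequence is merged into one [F]. Were its zero set of positive measure, saturation
    would give a [g] not vanishing on it, and [|F| + |g|] would beat the minimum. *)
Lemma saturated_finite_carrier (D : set T) : saturated mu mem ->
  measurable D -> (mu D < +oo)%E ->
  exists2 f, mem f & mu (D `&` [set x | f x = 0]) = 0%E.
Proof.
move=> sat mD Dfin.
have mDf f : mem f -> measurable (D `&` [set x | f x = 0]).
  by move=> If; apply: measurableI => //; exact/measurable_zeros/(il_meas I).
have fin A : measurable A -> A `<=` D -> mu A \is a fin_num.
  move=> mA AD; rewrite ge0_fin_numE//; apply: le_lt_trans Dfin.
  by apply: le_measure; rewrite ?inE.
pose E := [set fine (mu (D `&` [set x | f x = 0])) | f in mem].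
have hE : has_inf E.
  split; first by exists (fine (mu (D `&` [set x : T | (0 : R) = 0]))), (fun=> 0) => //; exact: (il_mem0 I).
  by exists 0 => _ [f _ <-]; rewrite fine_ge0.
have /choice[f fP] n : exists f, mem f /\
    fine (mu (D `&` [set x | f x = 0])) < inf E + (2^-1) ^+ n.
  have [_ [f If <-] Hf] := inf_adherent (halfX_gt0 n) hE.
  by exists f.
have [F IF Ff] := il_dom_scaled (fun n => (fP n).1).
pose A := D `&` [set x | F x = 0].
have mA : measurable A by exact: mDf.
have Ale : fine (mu A) <= inf E.
  apply/ler_addgt0Pr => e e0; have [N HN] := cvg0_lt cvg_half e0.
  have := HN N (leqnn _); rewrite gtr0_norm ?halfX_gt0// => /ltW HN'.
  apply: le_trans (lerD (lexx _) HN'); apply: le_trans (ltW (fP N).2).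
  apply: fine_le.
  - by apply: fin => // x [].
  - by apply: fin => [|x []//]; exact: mDf (fP N).1.
  apply: le_measure_ae => //; first exact: mDf (fP N).1.
  have [c c0] := Ff N; apply: filterS => x Fx [Dx /= F0]; split => //=.
  apply/eqP; rewrite -normr_le0; move: Fx; rewrite F0.
  by rewrite pmulr_rle0.
exists F => //; apply: contrapT => A0; apply: sat; exists A; split => //.
  by rewrite lt0e measure_ge0 andbT; exact/eqP.
move=> g Ig; apply: contrapT => Ag.
have mg := il_meas I Ig.
have Ih : mem (fun x => `|F x| + `|g x|).
  by apply: (il_memD I); [case: (il_norm IF)|case: (il_norm Ig)].
have : inf E <= fine (mu (A `&` [set x | g x = 0])).
  apply: ge_inf; first exact: hE.2.
  exists (fun x => `|F x| + `|g x|) => //; congr (fine (mu _)).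
  apply/seteqP; split => x /=.
    move=> [Dx /eqP]; rewrite paddr_eq0// !normr_eq0.
    by move=> /andP[/eqP ? /eqP ?].
  by move=> [[Dx ->] ->]; rewrite !normr0 addr0.
have mAg : measurable (A `&` [set x | g x = 0]).
  by apply: measurableI => //; exact: measurable_zeros.
have mAg' : measurable (A `\` [set x | g x = 0]).
  by apply: measurableD => //; exact: measurable_zeros.
have AD : A `<=` D by exact: subIsetl.
apply/negP; rewrite -ltNge; apply: lt_le_trans Ale.
have := measureDI mu mA (measurable_zeros mg).
rewrite -[X in (X + _)%E]fineK; last by apply: fin => // x [] /AD.
rewrite -[X in (_ + X)%E]fineK; last by apply: fin => // x [] /AD.
move=> ->; rewrite -EFinD /= ltrDr fine_gt0//.
rewrite (le_lt_trans _ Dfin) ?andbT; last first.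
  by apply: le_measure; rewrite ?inE// => x [] /AD.
rewrite lt0e measure_ge0 andbT; apply/eqP => Ag0; apply: Ag.
exists (A `\` [set x | g x = 0]); split => // x /= /not_implyP[Ax gx].
by split.
Qed.

Lemma weak_unit : sigma_finite setT mu -> saturated mu mem ->
  exists2 e, mem e & forall x, 0 < e x.
Proof.
move=> [D DT mD] sat.
have /choice[f fP] n : exists f, mem f /\ mu (D n `&` [set x | f x = 0]) = 0%E.
  have [mDn Dn] := mD n; have [f ? ?] := saturated_finite_carrier sat mDn Dn.
  by exists f.
have [e Ie He] := il_dom_scaled (fun n => (fP n).1).
have ae_e : {ae mu, forall x, 0 < e x}.
  have : {ae mu, forall x, forall n, D n x -> 0 < e x}.
    apply: ae_foralln => n; have [c c0 Hc] := He n.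
    have : {ae mu, forall x, D n x -> f n x != 0}.
      exists (D n `&` [set x | f n x = 0]); split => //; last first.
      - by move=> x /= /not_implyP[Dx /negP]; rewrite negbK => /eqP.
      - exact: (fP n).2.
      - apply: measurableI; first exact: (mD n).1.
        exact: measurable_zeros (il_meas I (fP n).1).
    apply: filterS2 Hc => x ex fx Dx; apply: lt_le_trans ex.
    by rewrite mulr_gt0// normr_gt0 fx.
  apply: filterS => x Hx; have : (\bigcup_n D n) x by rewrite -DT.
  by move=> [n _ /Hx].
(* Changing [e] on a null set stays in the space by solidity. Positivity at every point spares later
   divisions an exceptional set. *)
exists (fun x => if 0 < e x then e x else 1) => [|x]; last by case: ifPn.
apply: (il_solid I _ Ie _).1.
  apply: measurable_fun_ifT => //; last exact: (il_meas I).
  by apply: measurable_fun_ltr => //; exact: (il_meas I).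
by apply: filterS ae_e => x ->.
Qed.

End One.
End IdealSpaceTheory.

(** * Functionals represented by densities *)

Section UniformApproximation.
Context {d : measure_display} {T : measurableType d} {R : realType}.

Definition bounded_measurable (w : T -> R) :=
  measurable_fun setT w /\ exists c : R, forall x, `|w x| <= c.

Lemma indic_bounded_measurable (A : set T) : measurable A ->
  bounded_measurable (\1_A : T -> R).
Proof.
move=> mA; split; first exact: measurable_indic.
by exists 1 => x; rewrite indicE; case: (_ \in _); rewrite ?normr1 ?normr0.
Qed.

(** The sum is the integer part of [t], written with threshold tests so that for [t] depending on a
    point it becomes a sum of indicators of level sets. *)
Lemma count_le_dist (N : nat) (t : R) : 0 <= t -> t <= N%:R ->
  `|t - \sum_(i < N) (i.+1%:R <= t)%R%:R| <= 1.
Proof.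
move=> t0 tN; pose S n : R := \sum_(i < n) (i.+1%:R <= t)%R%:R.
have SP n : [/\ S n <= t, t < n.+1%:R -> t <= S n + 1 &
    n%:R <= t -> S n = n%:R].
  elim: n => [|n [S1 S2 S3]]; first by rewrite /S big_ord0; split => //; lra.
  have SS : S n.+1 = S n + (n.+1%:R <= t)%R%:R by rewrite /S big_ord_recr.
  have nS : n.+1%:R = n%:R + 1 :> R by rewrite -natr1.
  have nSS : n.+2%:R = n%:R + 2 :> R by rewrite -addn2 natrD.
  rewrite SS nSS; have [nt|nt] := leP n.+1%:R t; rewrite /= ?mulr1n ?mulr0n.
    by move: nt; rewrite nS => nt; rewrite S3; [split; lra|lra].
  by have h := S2 nt; move: nt; rewrite nS => nt; split; lra.
have [S1 S2 _] := SP N.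
rewrite ger0_norm ?subr_ge0// lerBlDl; apply: S2.
by apply: le_lt_trans tN _; rewrite ltr_nat.
Qed.

Variable L : (T -> R) -> R.
Hypothesis LD : forall f g, bounded_measurable f -> bounded_measurable g ->
  L (fun x => f x + g x) = L f + L g.
Hypothesis LZ : forall a f, bounded_measurable f ->
  L (fun x => a * f x) = a * L f.

Let bmD f g : bounded_measurable f -> bounded_measurable g ->
  bounded_measurable (fun x => f x + g x).
Proof.
move=> [mf [a fa]] [mg [b gb]]; split; first exact: measurable_funD.
by exists (a + b) => x; apply: le_trans (ler_normD _ _) _; exact: lerD.
Qed.

Let bmZ a f : bounded_measurable f -> bounded_measurable (fun x => a * f x).
Proof.
move=> [mf [c fc]]; split; first exact: measurable_funM.
by exists (`|a| * c) => x; rewrite normrM ler_wpM2l.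
Qed.

(** A multiple [m * w] (shifted to be nonnegative) is within 1 of a finite sum of indicators, on
    which [L] vanishes. Hence [m * |L w| <= C] for every [m]. *)
Lemma eq0_on_bounded_measurable (C : R) :
  (forall f, bounded_measurable f -> (forall x, `|f x| <= 1) -> `|L f| <= C) ->
  (forall A, measurable A -> L (\1_A) = 0) ->
  forall w, bounded_measurable w -> L w = 0.
Proof.
move=> Lb L1 w bw; have [mw [c0 wc0]] := bw.
pose n := (Num.trunc c0).+1.
have wn x : `|w x| <= n%:R by apply: le_trans (wc0 x) _; rewrite ltW// truncnS_gt.
(* The shift puts the values in the interval from 0 to [n + n], as [count_le_dist] requires, and
   leaves [L w] unchanged because [L] kills the indicator of the whole space. *)
pose w' x := w x + n%:R * \1_setT x.
have w'E x : w' x = w x + n%:R by rewrite /w' indicT mulr1.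
have bw' : bounded_measurable w' by apply: bmD => //; apply/bmZ/indic_bounded_measurable.
have Lw' : L w' = L w by rewrite LD ?LZ ?L1 ?mulr0 ?addr0//; [exact: indic_bounded_measurable|exact/bmZ/indic_bounded_measurable].
have bound (m : nat) : m%:R * `|L w| <= C.
  pose A i := [set x | i.+1%:R <= m%:R * w' x].
  have mA i : measurable (A i).
    rewrite -[X in measurable X]setTI; apply: measurable_fun_le => //.
    by apply: measurable_funM => //; exact: bw'.1.
  pose s N x : R := \sum_(i < N) \1_(A i) x.
  have sP N : bounded_measurable (s N) /\ L (s N) = 0.
    elim: N => [|N [bs Ls]].
      rewrite (_ : s 0%N = \1_set0); first by split; [exact: indic_bounded_measurable|exact: L1].
      by apply/funext => x; rewrite /s big_ord0 indic0.
    rewrite (_ : s N.+1 = fun x => s N x + \1_(A N) x); last first.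
      by apply/funext => x; rewrite /s big_ord_recr.
    by split; [exact/bmD/indic_bounded_measurable|rewrite LD ?Ls ?L1 ?addr0//; exact: indic_bounded_measurable].
  pose N := (m * (n + n))%N; have [bs Ls] := sP N.
  have -> : m%:R * `|L w| = `|L (fun x => m%:R * w' x + (-1) * s N x)|.
    rewrite LD ?LZ ?Lw' ?Ls ?mulr0 ?addr0 ?normrM//; try exact: bmZ.
    by rewrite ger0_norm.
  apply: Lb; first by apply: bmD; exact: bmZ.
  move=> x; rewrite mulN1r.
  have -> : s N x = \sum_(i < N) (i.+1%:R <= m%:R * w' x)%R%:R.
    by apply: eq_bigr => i _; rewrite indicE mem_setE.
  have := wn x; rewrite ler_norml => /andP[w1 w2].
  apply: count_le_dist; first by rewrite mulr_ge0// w'E; lra.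
  by rewrite /N natrM ler_wpM2l// natrD w'E; lra.
apply: contrapT => /eqP Lw0; have Lw1 : 0 < `|L w| by rewrite normr_gt0.
have := bound (Num.trunc (C / `|L w|)).+1.
by rewrite -ler_pdivlMr// leNgt truncnS_gt.
Qed.

End UniformApproximation.

Section SigmaFiniteCopy.
Context {d : measure_display} {T : measurableType d} {R : realType}.
Variables (mu : {measure set T -> \bar R}) (sf : sigma_finite setT mu).

(** Radon-Nikodym takes a bundled sigma-finite measure, while sigma-finiteness is here a hypothesis
    on [mu]. An alias that carries the proof as an argument can receive the structure and remains
    convertible to [mu]. *)
Definition sigma_finite_copy of sigma_finite setT mu : set T -> \bar R := mu.

HB.instance Definition _ := Measure.copy (sigma_finite_copy sf) mu.
HB.instance Definition _ :=
  Measure_isSigmaFinite.Build _ _ _ (sigma_finite_copy sf) sf.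

End SigmaFiniteCopy.

Section Representation.
Context {d : measure_display} {T : measurableType d} {R : realType}.
Variable mu : {measure set T -> \bar R}.

(** The principal order ideal of [v]. The bound holds at every point, so [u] vanishes where [v]
    does, and [u = (u / v) * v] is exact under the convention that 0 has inverse 0. *)
Definition order_bounded (v u : T -> R) :=
  measurable_fun setT u /\ exists c : R, forall x, `|u x| <= c * v x.

Lemma order_boundedD v f g : order_bounded v f -> order_bounded v g ->
  order_bounded v (fun x => f x + g x).
Proof.
move=> [mf [a fa]] [mg [b gb]]; split; first exact: measurable_funD.
exists (a + b) => x; apply: le_trans (ler_normD _ _) _.
by rewrite mulrDl; exact: lerD.
Qed.

Lemma order_boundedZ v a f : order_bounded v f ->
  order_bounded v (fun x => a * f x).
Proof.
move=> [mf [c fc]]; split; first exact: measurable_funM.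
by exists (`|a| * c) => x; rewrite normrM -mulrA ler_wpM2l.
Qed.

Lemma order_boundedM (v w : T -> R) : measurable_fun setT v -> (forall x, 0 <= v x) ->
  bounded_measurable w -> order_bounded v (fun x => w x * v x).
Proof.
move=> mv v0 [mw [c wc]]; split; first exact: measurable_funM.
by exists c => x; rewrite normrM (ger0_norm (v0 x)) ler_wpM2r.
Qed.

Lemma measurable_invr (f : T -> R) : measurable_fun setT f ->
  (forall x, 0 <= f x) -> measurable_fun setT (fun x => (f x)^-1).
Proof.
move=> mf f0; rewrite (_ : (fun _ => _) = fun x => powR (f x) (-1)).
  exact: measurableT_comp (measurable_powR _) mf.
by apply/funext => x; rewrite -powR_inv1.
Qed.

Variables (v : T -> R) (F : (T -> R) -> R).
Hypotheses (mv : measurable_fun setT v) (v_ge0 : forall x, 0 <= v x).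
Hypothesis FD : forall f g, order_bounded v f -> order_bounded v g ->
  F (fun x => f x + g x) = F f + F g.
Hypothesis FZ : forall a f, order_bounded v f ->
  F (fun x => a * f x) = a * F f.
Hypothesis Fbound : exists C : R, forall e u, 0 <= e -> order_bounded v u ->
  {ae mu, forall x, `|u x| <= e * v x} -> `|F u| <= e * C.
Hypothesis Fcont : forall A : nat -> set T, (forall n, measurable (A n)) ->
  (forall n, A n.+1 `<=` A n) -> \bigcap_n A n = set0 ->
  (fun n => F (fun x => \1_(A n) x * v x)) @ \oo --> (0 : R).

Definition functional_charge (A : set T) : \bar R :=
  (F (fun x => \1_A x * v x))%:E.

Let ob1 A : measurable A -> order_bounded v (fun x => \1_A x * v x).
Proof.
by move=> mA; apply: order_boundedM => //; exact: indic_bounded_measurable.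
Qed.

Let charge_set0 : functional_charge set0 = 0%E.
Proof.
rewrite /functional_charge; congr EFin.
rewrite -[RHS](mul0r (F (fun x => \1_set0 x * v x))) -FZ; last exact: ob1.
by congr F; apply/funext => x; rewrite indic0 !mul0r.
Qed.

Let charge_fin A : measurable A -> functional_charge A \is a fin_num.
Proof. by []. Qed.

Let charge_sigma_additive : semi_sigma_additive functional_charge.
Proof.
move=> E mE tE mUE.
(* The tails decrease to the empty set since the [E i] are disjoint; [Fcont] then removes the error
   left by a partial sum. *)
pose G n := \bigcup_(i in [set i | (n <= i)%N]) E i.
have mG n : measurable (G n) by apply: bigcup_measurable => i _.
have GE n : F (fun x => \1_(G n) x * v x) =
    F (fun x => \1_(E n) x * v x) + F (fun x => \1_(G n.+1) x * v x).
  rewrite -FD; [|exact: ob1..]; congr F; apply/funext => x.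
  rewrite -mulrDl; congr (_ * _); rewrite !indicE.
  have [En|En] := pselect (E n x).
    have Gn : G n x by exists n => //=.
    rewrite (mem_set En) (mem_set Gn).
    rewrite memNset ?addr0// => -[i /= ni Ei].
    by have := tE i n I I; move=> /(_ (ex_intro _ x (conj Ei En))) h;
      move: ni; rewrite h ltnn.
  rewrite (memNset En) add0r; congr (_ %:R); congr nat_of_bool.
  apply/idP/idP => /set_mem [i /= ni Ei]; apply/mem_set; exists i => //=.
    by rewrite ltn_neqAle ni andbT; apply/eqP => ni'; apply: En; rewrite ni'.
  exact: ltnW.
have sumE n : (\sum_(0 <= i < n) functional_charge (E i))%E =
    (F (fun x => \1_(\bigcup_i E i) x * v x) - F (fun x => \1_(G n) x * v x))%:E.
  elim: n => [|n IH].
    have -> : G 0%N = \bigcup_i E i.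
      by apply/seteqP; split => x [i _ Ei]; exists i.
    by rewrite big_nil subrr.
  rewrite big_nat_recr//= IH /functional_charge -EFinD; congr EFin.
  rewrite (GE n); ring.
rewrite (_ : (fun _ => _) = EFin \o (fun n =>
    F (fun x => \1_(\bigcup_i E i) x * v x) - F (fun x => \1_(G n) x * v x))).
  apply: cvg_EFin; first exact: nearW.
  rewrite -[X in _ --> X]subr0.
  apply: cvgB; first exact: cvg_cst.
  apply: Fcont => //.
    by move=> n x [i /= ni Ei]; exists i => //=; exact: ltnW.
  rewrite -subset0 => x Gx; have [i _ Ei] := Gx 0%N I.
  have [j /= ij Ej] := Gx i.+1 I.
  have h := tE i j I I (ex_intro _ x (conj Ei Ej)).
  by move: ij; rewrite h ltnn.
by apply/funext => n; rewrite sumE.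
Qed.

HB.instance Definition _ := isCharge.Build d T R functional_charge
  charge_set0 charge_fin charge_sigma_additive.

(** If [k] is the density of [A |-> F (\1_A * v)], then [g = k / v] works, since
    [g * u = k * (u / v)] with [u / v] bounded. The difference [L] between [F (w * v)] and the
    integral of [k * w] is zero on indicators and bounded on the unit ball, hence zero on all
    bounded measurable [w]. *)
Theorem functional_representation : sigma_finite setT mu ->
  exists g : T -> R, [/\ measurable_fun setT g, forall x, v x = 0 -> g x = 0 &
    forall u, order_bounded v u -> L1_mem mu (fun x => g x * u x) /\
      \int[mu]_x (g x * u x) = F u].
Proof.
move=> sf.
pose muS : {sigma_finite_measure set T -> \bar R} := sigma_finite_copy sf.
have [C FC] := Fbound.
have C0 : 0 <= C.
  have z : order_bounded v (fun=> 0).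
    by split => //; exists 0 => x; rewrite mul0r normr0.
  have := FC 1 _ ler01 z; rewrite mul1r.
  have h : {ae mu, forall x, `|(fun=> 0 : R) x| <= 1 * v x}.
    by apply: aeW => x; rewrite normr0 mul1r.
  by move=> /(_ h); apply: le_trans.
(* On a null set [A] the function [\1_A * v] is 0 a.e., so [Fbound] applies with [e = 0]. *)
have dom : functional_charge `<< muS.
  apply/null_content_dominatesP => A mA A0; congr EFin; apply/eqP.
  rewrite -normr_le0 -[leRHS](mul0r C); apply: FC => //; first exact: ob1.
  exists A; split => // x /= h; apply: contrapT => Ax; apply: h.
  by rewrite indicE memNset// !mul0r normr0.
pose k x := fine (Radon_Nikodym functional_charge muS x).
have kE x : (k x)%:E = Radon_Nikodym functional_charge muS x.
  by rewrite fineK//; exact: Radon_Nikodym_fin_num.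
have kint : mu.-integrable setT (EFin \o k).
  rewrite (_ : EFin \o k = Radon_Nikodym functional_charge muS).
    exact: (Radon_Nikodym_integrable dom).
  by apply/funext => x; rewrite /= kE.
have mk : measurable_fun setT k.
  by have /measurable_int/measurable_EFinP := kint.
have kw w : bounded_measurable w ->
    mu.-integrable setT (EFin \o (fun x => k x * w x)).
  move=> [mw [c wc]].
  apply: (le_integrable measurableT _ _ (integrableZl measurableT c kint)).
    exact/measurable_EFinP/measurable_funM.
  move=> x _ /=; rewrite lee_fin !normrM mulrC ler_wpM2r//.
  exact: le_trans (wc x) (ler_norm _).
have kA A : measurable A ->
    \int[mu]_x (k x * \1_A x) = F (fun x => \1_A x * v x).
  move=> mA; have h := Radon_Nikodym_integral dom mA; apply: EFin_inj.
  rewrite -[RHS]/(functional_charge A) [RHS]h /Rintegral fineK; last first.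
    exact/integrable_fin_num/kw/indic_bounded_measurable.
  rewrite [RHS]integral_mkcond; apply: eq_integral => x _.
  by rewrite patchE -kE indicE; case: ifPn; rewrite ?mulr1 ?mulr0.
pose L w := F (fun x => w x * v x) - \int[mu]_x (k x * w x).
have L0 w : bounded_measurable w -> L w = 0.
  have ob f : bounded_measurable f -> order_bounded v (fun x => f x * v x).
    exact: order_boundedM.
  apply: (@eq0_on_bounded_measurable _ _ _ L _ _ (C + \int[mu]_x `|k x|)).
  - move=> f g bf bg; rewrite /L.
    rewrite (_ : (fun x => (f x + g x) * v x) = fun x => f x * v x + g x * v x).
      rewrite FD; [|exact: ob..].
      under eq_Rintegral do rewrite mulrDr.
      by rewrite RintegralD//; [ring|exact: kw..].
    by apply/funext => x; rewrite mulrDl.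
  - move=> a f bf; rewrite /L.
    rewrite (_ : (fun x => (a * f x) * v x) = fun x => a * (f x * v x)).
      rewrite FZ; last exact: ob.
      under eq_Rintegral do rewrite mulrCA.
      by rewrite RintegralZl//; [ring|exact: kw].
    by apply/funext => x; rewrite mulrA.
  - move=> f bf f1; rewrite /L; apply: le_trans (ler_normB _ _) _.
    apply: lerD.
      rewrite -[leRHS]mul1r; apply: FC => //; first exact: ob.
      apply: aeW => x; rewrite normrM (ger0_norm (v_ge0 x)).
      by rewrite ler_wpM2r.
    apply: le_trans (le_normr_Rintegral measurableT (kw _ bf)) _.
    apply: le_Rintegral => //.
    + exact: integrable_norm (kw _ bf).
    + exact: integrable_norm kint.
    + by move=> x _; rewrite normrM ler_piMr.
  - by move=> A mA; rewrite /L kA// subrr.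
exists (fun x => k x * (v x)^-1); split.
- by apply: measurable_funM => //; exact: measurable_invr.
- by move=> x ->; rewrite invr0 mulr0.
move=> u [mu' [c uc]].
have bw : bounded_measurable (fun x => u x * (v x)^-1).
  split; first by apply: measurable_funM => //; exact: measurable_invr.
  exists `|c| => x; rewrite normrM normfV (ger0_norm (v_ge0 x)).
  have [->|vx] := eqVneq (v x) 0; first by rewrite invr0 mulr0.
  rewrite ler_pdivrMr ?lt0r ?vx ?v_ge0//.
  by apply: le_trans (uc x) _; rewrite ler_wpM2r// ler_norm.
have gE : (fun x => k x * (v x)^-1 * u x) = fun x => k x * (u x * (v x)^-1).
  by apply/funext => x; ring.
rewrite gE; split; first exact: kw.
have := L0 _ bw; rewrite /L => /subr0_eq <-; congr F; apply/funext => x.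
have [vx|vx] := eqVneq (v x) 0; last by rewrite mulfVK.
by rewrite vx mulr0; apply/esym/eqP; rewrite -normr_le0 -[leRHS](mulr0 c) -vx.
Qed.

End Representation.

(** * Koethe duals *)

Section KoetheDual.
Context {d : measure_display} {T : measurableType d} {R : realType}.
Variable mu : {measure set T -> \bar R}.

Lemma L1_memP (f : T -> R) : L1_mem mu f <->
  measurable_fun setT f /\ (\int[mu]_x (`|f x|)%:E < +oo)%E.
Proof.
split=> [/integrableP[mf fi]|[mf fi]]; first by split; [exact/measurable_EFinP|].
by apply/integrableP; split; [exact/measurable_EFinP|].
Qed.

Lemma measurable_abs_EFin (f : T -> R) : measurable_fun setT f ->
  measurable_fun setT (fun x => (`|f x|)%:E).
Proof. by move=> mf; exact/measurable_EFinP/measurable_normr. Qed.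

Lemma le_absint (f g : T -> R) : measurable_fun setT f -> measurable_fun setT g ->
  {ae mu, forall x, `|f x| <= `|g x|} ->
  (\int[mu]_x (`|f x|)%:E <= \int[mu]_x (`|g x|)%:E)%E.
Proof.
move=> mf mg fg; apply: ae_ge0_le_integral => //; try exact: measurable_abs_EFin.
by apply: filterS fg => x + _; rewrite lee_fin.
Qed.

Lemma absintZ a (f : T -> R) : measurable_fun setT f ->
  (\int[mu]_x (`|a * f x|)%:E = `|a|%:E * \int[mu]_x (`|f x|)%:E)%E.
Proof.
move=> mf; under eq_integral do rewrite normrM EFinM.
by rewrite ge0_integralZl_EFin//; exact: measurable_abs_EFin.
Qed.

Lemma absint_ge0 (f : T -> R) : (0 <= \int[mu]_x (`|f x|)%:E)%E.
Proof. exact: integral_ge0. Qed.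

Lemma nneseries_half_le (a : nat -> \bar R) (c : R) : 0 <= c ->
  (forall n, 0 <= a n)%E -> (forall n, (a n <= (c * (2^-1) ^+ n)%:E)%E) ->
  (\sum_(0 <= n <oo) a n <= (2 * c)%:E)%E.
Proof.
move=> c0 a0 ac; apply: lime_le; first exact: is_cvg_nneseries.
apply: nearW => n.
apply: (@le_trans _ _ (2 * c - 2 * c * (2^-1) ^+ n)%:E).
  elim: n => [|n IH]; first by rewrite big_nil lee_fin expr0; lra.
  rewrite big_nat_recr//=; apply: le_trans (leeD IH (ac n)) _.
  by rewrite -EFinD lee_fin exprS; lra.
by rewrite lee_fin lerBlDr lerDl !mulr_ge0// ltW// halfX_gt0.
Qed.

Variables (mem : (T -> R) -> Prop) (nrm : (T -> R) -> \bar R).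
Hypothesis I : ideal_space mu mem nrm.
Local Notation K := (kdual_mem mu mem).
Local Notation KN := (kdual_norm mu mem nrm).

Lemma kdual_meas h : K h -> measurable_fun setT h. Proof. by case. Qed.

Let mM (h f : T -> R) : measurable_fun setT h -> mem f ->
  measurable_fun setT (fun x => h x * f x).
Proof. by move=> mh If; apply: measurable_funM => //; exact: (il_meas I). Qed.

Lemma kdual_mem_fin h f : K h -> mem f ->
  (\int[mu]_x (`|h x * f x|)%:E)%E \is a fin_num.
Proof.
move=> [mh hK] If; rewrite ge0_fin_numE ?absint_ge0//.
by have [_] := (L1_memP _).1 (hK _ If).
Qed.

Let kdual_bounded h : K h -> exists2 C : R, 0 < C &
  forall f, mem f -> (\int[mu]_x (`|h x * f x|)%:E <= C%:E * nrm f)%E.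
Proof.
move=> Kh; have mh := kdual_meas Kh; apply: (il_bounded I).
- by move=> f If; exact: kdual_mem_fin.
- move=> f g If Ig fg; apply: le_absint; [exact: mM|exact: mM|].
  by apply: filterS fg => x fgx; rewrite !normrM ler_wpM2l.
- move=> a f If; rewrite -absintZ; last exact: mM.
  by apply: eq_integral => x _; rewrite mulrCA.
Qed.

Lemma kdual_norm_ge0 h : (0 <= KN h)%E.
Proof.
apply: le_trans (ereal_sup_ubound _); first exact: (@absint_ge0 (fun x => h x * 0)).
exists (fun=> 0) => //=; split; first exact: (il_mem0 I).
by rewrite (il_norm0 I).
Qed.

Lemma kdual_norm_fin h : K h -> KN h \is a fin_num.
Proof.
move=> Kh; have [C C0 HC] := kdual_bounded Kh.
rewrite ge0_fin_numE ?kdual_norm_ge0//; apply: (@le_lt_trans _ _ C%:E).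
  2: exact: ltry.
apply: ge_ereal_sup => _ [f [If f1] <-]; apply: le_trans (HC _ If) _.
by rewrite -[leRHS]mule1; apply: lee_wpmul2l => //; rewrite lee_fin ltW.
Qed.

Lemma hoelder_kdual h f : K h -> mem f ->
  (\int[mu]_x (`|h x * f x|)%:E <= KN h * nrm f)%E.
Proof.
move=> Kh If; have mh := kdual_meas Kh.
have nE := fineK (il_fin I If); set N := fine (nrm f) in nE.
have N0 : 0 <= N by rewrite fine_ge0// (il_ge0 I).
(* An [f] of norm 0 cannot be normalised; the finite constant of [kdual_bounded] shows that its
   integral vanishes. *)
move: N0; rewrite le_eqVlt => /predU1P[N0|N0].
  have [C _ HC] := kdual_bounded Kh.
  by have := HC _ If; rewrite -nE -N0 !mule0.
have : (\int[mu]_x (`|h x * (N^-1 * f x)|)%:E <= KN h)%E.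
  apply: ereal_sup_ubound; exists (fun x => N^-1 * f x) => //=.
  split; first exact: (il_memZ I).
  by rewrite (il_normZ I)// -nE -EFinM lee_fin gtr0_norm ?invr_gt0// mulVf// gt_eqF.
under eq_integral do rewrite mulrCA.
rewrite absintZ; last exact: mM.
rewrite gtr0_norm ?invr_gt0// -nE -(fineK (kdual_mem_fin Kh If)).
rewrite -(fineK (kdual_norm_fin Kh)) -!EFinM !lee_fin.
by rewrite ler_pdivrMl// mulrC.
Qed.

Lemma kdual_solid (h g : T -> R) : measurable_fun setT h -> K g ->
  {ae mu, forall x, `|h x| <= `|g x|} -> K h /\ (KN h <= KN g)%E.
Proof.
move=> mh Kg hg.
have le f : mem f ->
    (\int[mu]_x (`|h x * f x|)%:E <= \int[mu]_x (`|g x * f x|)%:E)%E.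
  move=> If; apply: le_absint; [exact: mM|exact: mM (kdual_meas Kg) If|].
  by apply: filterS hg => x hgx; rewrite !normrM ler_wpM2r.
split.
  split => // f If; apply/L1_memP; split; first exact: mM.
  by apply: le_lt_trans (le _ If) _; rewrite -ge0_fin_numE ?absint_ge0// kdual_mem_fin.
apply: ge_ereal_sup => _ [f [If f1] <-]; apply: le_trans (le _ If) _.
by apply: ereal_sup_ubound; exists f.
Qed.

Lemma kdual_memZ a h : K h -> K (fun x => a * h x).
Proof.
move=> Kh; have mh := kdual_meas Kh; split; first exact: measurable_funM.
move=> f If; apply/L1_memP; split.
  by apply: mM => //; exact: measurable_funM.
under eq_integral do rewrite -mulrA.
rewrite absintZ; last exact: mM.
by rewrite -(fineK (kdual_mem_fin Kh If)) -EFinM ltry.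
Qed.

Lemma kdual_normZ a h : K h -> KN (fun x => a * h x) = (`|a|%:E * KN h)%E.
Proof.
have le b k : K k -> (KN (fun x => (b * k x)%R) <= `|b|%:E * KN k)%E.
  move=> Kk; apply: ge_ereal_sup => _ [f [If f1] <-].
  under eq_integral do rewrite -mulrA.
  rewrite absintZ; last exact: mM (kdual_meas Kk) If.
  by apply: lee_wpmul2l => //; apply: ereal_sup_ubound; exists f.
move=> Kh; apply/eqP; rewrite eq_le le//=.
have [->|a0] := eqVneq a 0; first by rewrite normr0 mul0e kdual_norm_ge0.
have := le a^-1 _ (kdual_memZ a Kh).
under eq_fun do rewrite mulKf//.
rewrite -(fineK (kdual_norm_fin Kh)) -(fineK (kdual_norm_fin (kdual_memZ a Kh))).
by rewrite -!EFinM !lee_fin normfV ler_pdivlMl ?normr_gt0.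
Qed.

Lemma kdual_memD h g : K h -> K g -> K (fun x => h x + g x).
Proof.
move=> [mh hK] [mg gK]; split; first exact: measurable_funD.
move=> f If; rewrite (_ : (fun _ => _) = fun x => h x * f x + g x * f x).
  have := integrableD measurableT (hK _ If) (gK _ If).
  by apply: eq_integrable.
by apply/funext => x; rewrite mulrDl.
Qed.

Lemma kdual_normD h g : K h -> K g ->
  (KN (fun x => (h x + g x)%R) <= KN h + KN g)%E.
Proof.
move=> Kh Kg; have mh := kdual_meas Kh; have mg := kdual_meas Kg.
apply: ge_ereal_sup => _ [f [If f1] <-].
apply: (@le_trans _ _ (\int[mu]_x ((`|h x * f x|)%:E + (`|g x * f x|)%:E))%E).
  apply: ge0_le_integral => //.
  - by apply/measurable_abs_EFin/mM => //; exact: measurable_funD.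
  - by apply: emeasurable_funD; exact/measurable_abs_EFin/mM.
  - by move=> x _; rewrite -EFinD lee_fin mulrDl ler_normD.
rewrite ge0_integralD//; [|exact/measurable_abs_EFin/mM..].
by apply: leeD; apply: ereal_sup_ubound; exists f.
Qed.

(* The a.e. finiteness of the dominating sum is read off against a weak unit. *)
Lemma kdual_dom (u : nat -> T -> R) : sigma_finite setT mu ->
  saturated mu mem -> (forall n, K (u n)) ->
  (forall n, (KN (u n) <= ((2^-1 : R) ^+ n)%:E)%E) ->
  exists2 F, K F & forall n, {ae mu, forall x, `|u n x| <= F x}.
Proof.
move=> sf sat Ku un.
pose G x := (\sum_(0 <= n <oo) (`|u n x|)%:E)%E.
have G0 x : (0 <= G x)%E by apply: nneseries_ge0 => n _ _; rewrite lee_fin.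
have mG : measurable_fun setT G.
  apply: (@ge0_emeasurable_sum _ _ _ _ (fun n x => (`|u n x|)%:E) xpredT).
    by move=> k x _ _; rewrite lee_fin.
  by move=> k _; exact: measurable_abs_EFin (kdual_meas (Ku k)).
have Gf f : mem f -> (\int[mu]_x (G x * (`|f x|)%:E) < +oo)%E.
  move=> If.
  rewrite (eq_integral (fun x => \sum_(0 <= n <oo) (`|u n x * f x|)%:E)%E).
    rewrite integral_nneseries//; last first.
      by move=> n; apply/measurable_abs_EFin/mM => //; exact: (kdual_meas (Ku n)).
    have nE := fineK (il_fin I If).
    apply: (@le_lt_trans _ _ (2 * fine (nrm f))%:E); last exact: ltry.
    apply: nneseries_half_le; first by rewrite fine_ge0// (il_ge0 I).
      by move=> n; exact: absint_ge0.
    move=> n; apply: le_trans (hoelder_kdual (Ku n) If) _.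
    rewrite mulrC EFinM nE; apply: lee_wpmul2r => //; exact: (il_ge0 I).
  move=> x _; rewrite muleC -nneseriesZl; last by move=> n _; rewrite lee_fin.
  by apply: eq_eseriesr => n _; rewrite -EFinM mulrC normrM.
have [e Ie e0] := weak_unit I sf sat.
have Gfin : {ae mu, forall x, G x \is a fin_num}.
  have : mu.-integrable setT (fun x => (G x * (`|e x|)%:E)%E).
    apply/integrableP; split.
      by apply: emeasurable_funM => //; exact/measurable_abs_EFin/(il_meas I).
    by under eq_integral do rewrite gee0_abs ?mule_ge0//; exact: Gf.
  move=> /(integrable_ae measurableT); apply: filterS => x /(_ Logic.I).
  rewrite !ge0_fin_numE ?mule_ge0// => h.
  have : (0 < (`|e x|)%:E)%E by rewrite lte_fin normr_gt0 gt_eqF.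
  move: h; have := G0 x; case: (G x) => [r _ _ _|_ h ex|//]; first exact: ltry.
  by move: h; rewrite gt0_mulye.
(* [fine] replaces infinite values by 0. This keeps the function below [G] everywhere, which gives
   membership, and alters [G] only on a null set, which preserves the domination. *)
exists (fun x => fine (G x)).
  split; first exact: measurableT_comp (@fine_measurable _ _ measurableT) mG.
  have mF : measurable_fun setT (fun x => fine (G x)).
    exact: measurableT_comp (@fine_measurable _ _ measurableT) mG.
  move=> f If; apply/L1_memP; split; first exact: mM.
  apply: le_lt_trans (Gf _ If); apply: ge0_le_integral => //.
  - exact/measurable_abs_EFin/mM.
  - by apply: emeasurable_funM => //; exact/measurable_abs_EFin/(il_meas I).
  - move=> x _; rewrite normrM EFinM; apply: lee_wpmul2r => //.
    rewrite ger0_norm ?fine_ge0//.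
    by have := G0 x; case: (G x) => [r|_|//]; rewrite ?leey.
move=> n; apply: filterS Gfin => x Gx; rewrite -lee_fin fineK//.
apply: le_trans (nneseries_lim_ge n.+1 _); last by move=> k _ _; rewrite lee_fin.
rewrite big_nat_recr//= leeDr// sume_ge0// => k _.
Qed.

Lemma kdual_ideal_space : sigma_finite setT mu -> saturated mu mem ->
  ideal_space mu K KN.
Proof.
move=> sf sat; split.
- exact: kdual_meas.
- split=> // f If; apply/L1_memP; split; first exact: mM.
  by under eq_integral do rewrite mul0r normr0; rewrite integral0.
- exact: kdual_memD.
- exact: kdual_memZ.
- exact: kdual_norm_fin.
- by move=> f _; exact: kdual_norm_ge0.
- exact: kdual_normD.
- exact: kdual_normZ.
- exact: kdual_solid.
- by move=> u; exact: kdual_dom.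
Qed.

End KoetheDual.

(** * Saturation of the Koethe dual of a saturated space *)

Section KoetheDualSaturated.
Context {d : measure_display} {T : measurableType d} {R : realType}.
Variable mu : {measure set T -> \bar R}.
Variables (mem : (T -> R) -> Prop) (nrm : (T -> R) -> \bar R).
Hypotheses (I : ideal_space mu mem nrm) (sf : sigma_finite setT mu)
  (sat : saturated mu mem).

Lemma measurable_sgr (f : T -> R) : measurable_fun setT f ->
  measurable_fun setT (fun x => Num.sg (f x)).
Proof.
move=> mf; rewrite (_ : (fun _ => _) =
    fun x => if 0 < f x then 1 else if f x < 0 then -1 else 0).
  apply: measurable_fun_ifT => //; first exact: measurable_fun_ltr.
  by apply: measurable_fun_ifT => //; exact: measurable_fun_ltr.
by apply/funext => x; case: sgrP.
Qed.

Lemma L1_memD (f g : T -> R) : L1_mem mu f -> L1_mem mu g ->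
  L1_mem mu (fun x => f x + g x).
Proof. exact: integrableD. Qed.

Lemma L1_memZ a (f : T -> R) : L1_mem mu f -> L1_mem mu (fun x => a * f x).
Proof. exact: integrableZl. Qed.

Lemma L1_mem_norm (f : T -> R) : L1_mem mu f -> L1_mem mu (fun x => `|f x|).
Proof. exact: integrable_norm. Qed.

(** A weak unit [e] is positive everywhere, so the sets where [k.+1 * e >= 1], cut by a sigma-finite
    exhaustion, cover [A]. One of them meets [A] in positive measure, and its indicator is below
    [k.+1 * e]. *)
Lemma exists_indicator_mem (A : set T) : measurable A -> (0 < mu A)%E ->
  exists B, [/\ measurable B, B `<=` A, (mu B < +oo)%E, (0 < mu B)%E &
    mem (\1_B)].
Proof.
move=> mA A0; have [D DT mD] := sf; have [e Ie e0] := weak_unit I sf sat.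
have me := il_meas I Ie.
pose B n k := A `&` (D n `&` [set x | 1 <= k.+1%:R * e x]).
have mB n k : measurable (B n k).
  apply: measurableI => //; apply: measurableI; first exact: (mD n).1.
  rewrite -[X in measurable X]setTI; apply: measurable_fun_le => //.
  exact: measurable_funM.
have [[n [k B0]]|noB] := pselect (exists n k, (0 < mu (B n k))%E).
  exists (B n k); split => //; first by move=> x [].
    apply: le_lt_trans (mD n).2; apply: le_measure; rewrite ?inE//.
      exact: (mD n).1.
    by move=> x [_ []].
  have mBk : measurable_fun setT (\1_(B n k) : T -> R) by exact: measurable_indic.
  apply: (il_solid I mBk (il_memZ I k.+1%:R Ie) _).1.
  apply: aeW => x; rewrite indicE; have [xB|xB] := boolP (x \in B n k).
    move: xB => /set_mem [_ [_ /= xB]].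
    by rewrite normr1 (le_trans xB)// ler_norm.
  by rewrite normr0.
exfalso; have : mu.-negligible A.
  apply: (@negligibleS _ _ _ _ (\bigcup_n \bigcup_k B n k)).
    move=> x Ax; have : (\bigcup_n D n) x by rewrite -DT.
    move=> [n _ Dx]; exists n => //.
    exists (Num.trunc (e x)^-1) => //; split => //; split => //=.
    rewrite -ler_pdivrMr// div1r; apply: ltW; exact: truncnS_gt.
  apply: negligible_bigcup => n; apply: negligible_bigcup => k.
  apply/negligibleP => //; apply/eqP; rewrite eq_le measure_ge0 andbT leNgt.
  by apply/negP => B0; apply: noB; exists n, k.
by move/(measure_negligible mA) => A00; rewrite A00 ltxx in A0.
Qed.

Variable B : set T.
Hypotheses (mB : measurable B) (B_fin : (mu B < +oo)%E) (IB : mem (\1_B)).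
Let v : T -> R := \1_B.
Let Z := [set u | order_bounded v u].

Let mv : measurable_fun setT v. Proof. exact: measurable_indic. Qed.
Let v_ge0 x : 0 <= v x. Proof. by rewrite /v indicE. Qed.
Let v_L1 : L1_mem mu v.
Proof.
apply/L1_memP; split => //; under eq_integral do rewrite ger0_norm//.
by rewrite integral_indic// setIT.
Qed.

Let Zmem u : Z u -> mem u.
Proof.
move=> [mu' [c uc]]; apply: (il_solid I mu' (il_memZ I c IB) _).1.
by apply: aeW => x; apply: le_trans (uc x) _; rewrite ler_norm.
Qed.

Let ZL1 u : Z u -> L1_mem mu u.
Proof.
move=> [mu' [c uc]]; apply: (le_integrable measurableT _ _ (L1_memZ c v_L1)).
  exact/measurable_EFinP.
by move=> x _ /=; rewrite lee_fin (le_trans (uc x))// ler_norm.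
Qed.

(* The infimal convolution of nrm and the L1 norm: functionals below it lie in
   the Koethe dual and are given by densities. *)
Let Q u := [set fine (nrm f) + \int[mu]_x `|u x - f x| |
  f in [set f | mem f /\ L1_mem mu (fun x => u x - f x)]].
Let q u := inf (Q u).

Let Q_ge0 u : lbound (Q u) 0.
Proof.
move=> _ [f [If _] <-]; apply: addr_ge0; first by rewrite fine_ge0// (il_ge0 I).
exact: Rintegral_ge0.
Qed.

Let q_le u f : mem f -> L1_mem mu (fun x => u x - f x) ->
  q u <= fine (nrm f) + \int[mu]_x `|u x - f x|.
Proof. by move=> If Lf; apply: ge_inf; [exists 0; exact: Q_ge0|exists f]. Qed.

Let Q_ex u : Z u -> exists r, Q u r.
Proof.
move=> Zu; exists (fine (nrm (fun=> 0)) + \int[mu]_x `|u x - 0|), (fun=> 0) => //.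
split; first exact: (il_mem0 I).
by under eq_fun do rewrite subr0; exact: ZL1.
Qed.

Let q_ge u c : Z u -> (forall f, mem f -> L1_mem mu (fun x => u x - f x) ->
  c <= fine (nrm f) + \int[mu]_x `|u x - f x|) -> c <= q u.
Proof.
move=> Zu h; apply: lb_le_inf; first by have [r] := Q_ex Zu; exists r.
by move=> _ [f [If Lf] <-]; exact: h.
Qed.

Let q_ge0 u : Z u -> 0 <= q u.
Proof. by move=> Zu; apply: q_ge => // f If Lf; apply: (@Q_ge0 u); exists f. Qed.

Let q_le_L1 u : Z u -> q u <= \int[mu]_x `|u x|.
Proof.
move=> Zu; have := @q_le u _ (il_mem0 I); rewrite (il_norm0 I) add0r.
under eq_fun do rewrite subr0.
by under eq_Rintegral do rewrite subr0; apply; exact: ZL1.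
Qed.

Let q_le_nrm u : Z u -> q u <= fine (nrm u).
Proof.
move=> Zu; have := @q_le u _ (Zmem Zu); under eq_fun do rewrite subrr.
under eq_Rintegral do rewrite subrr normr0.
by rewrite Rintegral_cst// mul0r addr0; apply; exact: integrable0.
Qed.

Let ZD f g : Z f -> Z g -> Z (fun x => f x + g x).
Proof. exact: order_boundedD. Qed.

Let ZZ a f : Z f -> Z (fun x => a * f x).
Proof. exact: order_boundedZ. Qed.

Let qZ a u : 0 < a -> Z u -> q (fun x => a * u x) <= a * q u.
Proof.
move=> a0 Zu; rewrite -ler_pdivrMl//; apply: q_ge => // f If Lf.
rewrite ler_pdivrMl//.
have E : (fun x => a * u x - a * f x) = fun x => a * (u x - f x).
  by apply/funext => x; rewrite mulrBr.
have := @q_le (fun x => a * u x) _ (il_memZ I a If).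
rewrite E => /(_ (L1_memZ a Lf)) /le_trans; apply.
rewrite (il_normZ I)// -(fineK (il_fin I If)) -EFinM/= gtr0_norm// mulrDr.
rewrite lerD2l -RintegralZl//; last exact: L1_mem_norm.
rewrite le_eqVlt; apply/orP; left; apply/eqP; apply: eq_Rintegral => x _.
by rewrite -mulrBr normrM gtr0_norm.
Qed.

Let q_sublinear : sublinear_on Z q.
Proof.
split=> [u w Zu Zw|a u].
  rewrite -lerBlDr; apply: q_ge => // f If Lf.
  rewrite lerBlDl -lerBlDr; apply: q_ge => // g Ig Lg; rewrite lerBlDl.
  have E : (fun x => u x + w x - (f x + g x)) =
      fun x => (u x - f x) + (w x - g x) by apply/funext => x; ring.
  have := @q_le (fun x => u x + w x) _ (il_memD I If Ig).
  rewrite E => /(_ (L1_memD Lf Lg)) /le_trans; apply.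
  rewrite addrACA; apply: lerD.
    rewrite -fineD ?(il_fin I)//; apply: fine_le.
    - by apply: (il_fin I); exact: (il_memD I).
    - by rewrite fin_numD !(il_fin I).
    - exact: (il_normD I).
  rewrite -RintegralD//; [|exact: L1_mem_norm..].
  apply: le_Rintegral => //.
  - by have := L1_memD Lf Lg; rewrite -E => /L1_mem_norm.
  - by apply: L1_memD; exact: L1_mem_norm.
  - move=> x _; apply: le_trans (ler_normD _ _).
    by rewrite le_eqVlt; apply/orP; left; apply/eqP; congr (`|_|); ring.
rewrite le_eqVlt => /predU1P[<- Zu|a0 Zu]; last exact: qZ.
rewrite mul0r; apply: le_trans (q_le_L1 (ZZ 0 Zu)) _.
by under eq_Rintegral do rewrite mul0r normr0; rewrite Rintegral_cst// mul0r.
Qed.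

Let Zv : Z v.
Proof. by split => //; exists 1 => x; rewrite mul1r ger0_norm. Qed.

(** If [q v] were 0, there would be [f n] of norm below [4 ^- n] and with L1 distance to [v] below
    [4 ^- n]. The first bound sends [f n] to 0 a.e., the second then forces the integral of [v] to
    be 0. *)
Let q_pos : (0 < mu B)%E -> 0 < q v.
Proof.
move=> B0; rewrite lt_neqAle q_ge0// andbT; apply/eqP => qv0.
have hQ : has_inf (Q v) by split; [exact: Q_ex|exists 0; exact: Q_ge0].
have /choice[f fP] n : exists f, [/\ mem f, L1_mem mu (fun x => v x - f x) &
    fine (nrm f) + \int[mu]_x `|v x - f x| < (4^-1) ^+ n].
  have e0 : 0 < (4^-1 : R) ^+ n by rewrite exprn_gt0// invr_gt0.
  have [_ [f [If Lf] <-]] := inf_adherent e0 hQ.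
  by rewrite -/(q v) -qv0 add0r; exists f.
have If n : mem (f n) by case: (fP n).
have f0 : {ae mu, forall x, (fun n => f n x) @ \oo --> (0 : R)}.
  apply: (il_ae_cvg0 I If) => n; have [_ _ h] := fP n.
  rewrite -(fineK (il_fin I (If n))) lee_fin; apply: le_trans (ltW h).
  by rewrite lerDl; exact: Rintegral_ge0.
(* Capping by [v] provides an integrable majorant; the limit is still [v] because
   [|v - h n| <= |f n|]. *)
pose h n x := Num.min (v x) `|v x - f n x|.
have mh n : measurable_fun setT (h n).
  apply: measurable_minr => //; apply: measurable_normr.
  by apply: measurable_funB => //; exact: (il_meas I (If n)).
have h_ge0 n x : 0 <= h n x by rewrite le_min v_ge0 normr_ge0.
have hE n x : `|(h n x)%:E|%E = (h n x)%:E by rewrite gee0_abs// lee_fin.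
have [||||_ _ cv] := @dominated_convergence _ _ _ mu _ measurableT
    (fun n x => (h n x)%:E) (EFin \o v) (EFin \o v) _ _ _ v_L1.
- by move=> n; exact/measurable_EFinP.
- exact/measurable_EFinP.
- apply: filterS f0 => x fx _; apply: cvg_EFin; first exact: nearW.
  have hb n : `|v x - h n x| <= `|f n x|.
    rewrite /h minEle; case: ifPn => _; first by rewrite subrr normr0.
    rewrite -{1}(ger0_norm (v_ge0 x)); apply: le_trans (ler_dist_dist _ _) _.
    by rewrite opprB addrC subrK.
  apply/cvgrPdist_lt => e e0; have [N HN] := cvg0_lt fx e0.
  by exists N => // n /= /HN; apply: le_lt_trans.
- by apply: aeW => x n _; rewrite hE lee_fin ge_min lexx.
have : (\int[mu]_x (v x)%:E <= 0)%E.
  apply/lee_addgt0Pr => e e0; rewrite add0e.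
  apply: (cvge_to_le cv).
  have [|N HN] := @cvg0_lt R (fun n => (4^-1) ^+ n) e _ e0.
    by apply: cvg_expr; rewrite ger0_norm; lra.
  exists N => // n /= Nn.
  have [_ Lf /ltW h1] := fP n.
  apply: (@le_trans _ _ ((4^-1) ^+ n)%:E); last first.
    by rewrite lee_fin; have := HN n Nn => /ltW; apply: le_trans; exact: ler_norm.
  apply: (@le_trans _ _ (\int[mu]_x `|v x - f n x|)%:E).
    rewrite /Rintegral fineK; last first.
      apply: integrable_fin_num => //; exact: L1_mem_norm.
    apply: ge0_le_integral => //.
    - by move=> x _; rewrite lee_fin.
    - exact/measurable_EFinP.
    - apply: measurable_abs_EFin; apply: measurable_funB => //.
      exact: (il_meas I (If n)).
    - by move=> x _; rewrite lee_fin ge_min lexx orbT.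
  rewrite lee_fin; apply: le_trans h1; rewrite lerDr fine_ge0//.
  exact: (il_ge0 I).
rewrite integral_indic// setIT leNgt; exact/negP/negPn.
Qed.

(** Mazur-Orlicz on the ray through [(v, q v)] gives [F] below [q] with [F v >= q v > 0]. From [q]
    below the L1 norm, [F] is countably additive and has a density [g]; from [q] below [nrm], [g]
    lies in the dual; and [F v > 0] shows that [g] is not 0 on [B]. *)
Lemma kdual_nonzero_on : (0 < mu B)%E -> exists g, kdual_mem mu mem g /\
  ~ {ae mu, forall x, B x -> g x = 0}.
Proof.
move=> B0.
pose D : set ((T -> R) * R) :=
  [set (fun x => t * v x, t * q v) | t in [set t | 0 <= t]].
have Z0 : Z (fun=> 0) by split => //; exists 0 => x; rewrite normr0 mul0r.
have [|||| F [FD FZ Fq FDv]] := @mazur_orlicz_fun _ _ Z D q Z0 ZD ZZ q_sublinear.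
- exists 0 => //=; rewrite mul0r; congr pair.
  by apply/funext => x; rewrite mul0r.
- move=> _ _ [s s0 <-] [t t0 <-]; exists (s + t); first exact: addr_ge0.
  by rewrite /= mulrDl; congr pair; apply/funext => x; rewrite mulrDl.
- move=> a _ a0 [s s0 <-]; exists (a * s); first exact: mulr_ge0.
  by rewrite /= mulrA; congr pair; apply/funext => x; rewrite mulrA.
- move=> _ [t t0 <-] /=; split; first exact: ZZ.
  move: t0; rewrite /= le_eqVlt => /predU1P[<-|t0].
    by rewrite mul0r; apply: q_ge0; exact: ZZ.
  have ti : 0 < t^-1 by rewrite invr_gt0.
  have := qZ ti (ZZ t Zv); under eq_fun do rewrite mulKf ?gt_eqF//.
  by rewrite ler_pdivlMl.
have Fv : 0 < F v.
  apply: lt_le_trans (q_pos B0) _.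
  have Dv : D (v, q v).
    exists 1 => //=; rewrite mul1r; congr pair.
    by apply/funext => x; rewrite mul1r.
  exact: FDv Dv.
have FL1 u : Z u -> `|F u| <= \int[mu]_x `|u x|.
  move=> Zu; rewrite ler_norml lerNl; apply/andP; split.
    rewrite -mulN1r -FZ//; apply: le_trans (Fq _ (ZZ _ Zu)) _.
    apply: le_trans (q_le_L1 (ZZ _ Zu)) _.
    by under eq_Rintegral do rewrite mulN1r normrN.
  exact: le_trans (Fq _ Zu) (q_le_L1 Zu).
have vint : \int[mu]_x v x = fine (mu B).
  by rewrite /Rintegral integral_indic// setIT.
have [||g [mg g0 gF]] := functional_representation mv v_ge0 FD FZ _ _ sf.
- exists (\int[mu]_x v x) => e u e0 Zu ue; apply: le_trans (FL1 _ Zu) _.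
  rewrite -RintegralZl// /Rintegral; apply: fine_le.
  + by apply: integrable_fin_num => //; exact/L1_mem_norm/ZL1.
  + by apply: integrable_fin_num => //; exact: L1_memZ.
  + apply: ae_ge0_le_integral => //.
    * exact/measurable_abs_EFin/Zu.1.
    * by move=> x _; rewrite lee_fin mulr_ge0.
    * by apply/measurable_EFinP; exact: measurable_funM.
    * by apply: filterS ue => x + _; rewrite lee_fin.
- move=> A mA nA A0; apply/cvgr0Pnorm_lt => e e0.
  have mAB n : measurable (A n `&` B) by exact: measurableI.
  have cv : mu \o (fun n => A n `&` B) @ \oo --> mu (\bigcap_n (A n `&` B)).
    apply: nonincreasing_cvg_mu => //.
    - apply: le_lt_trans B_fin; apply: le_measure; rewrite ?inE//.
    - by apply: bigcap_measurable => //; exists 0%N.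
    - apply/nonincreasing_seqP => n; apply/subsetPset => x [Ax Bx].
      by split => //; exact: nA.
  have cap0 : \bigcap_n (A n `&` B) = set0.
    by rewrite -subset0 -A0 => x Ax n _; case: (Ax n Logic.I).
  rewrite cap0 measure0 in cv.
  have [N HN] := cvge0_lt cv e0; exists N => // n /= /HN /= hn.
  have Zn : Z (fun x => \1_(A n) x * v x).
    by apply: order_boundedM => //; exact: indic_bounded_measurable.
  apply: le_lt_trans (FL1 _ Zn) _.
  have -> : \int[mu]_x `|\1_(A n) x * v x| = fine (mu (A n `&` B)).
    rewrite /Rintegral -[in RHS](setIT (A n `&` B)) -integral_indic//.
    congr fine; apply: eq_integral => x _.
    by rewrite ger0_norm ?mulr_ge0// indicI.
  rewrite -lte_fin fineK// ge0_fin_numE//; apply: lt_trans hn _; exact: ltry.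
exists g; split; last first.
  move=> ag; have [_ gv] := gF v Zv; move: Fv; rewrite -gv.
  rewrite (_ : Rintegral _ _ _ = 0) ?ltxx// /Rintegral.
  rewrite (@ae_eq_integral _ _ _ mu setT (cst 0%E))//.
  - by rewrite integral0.
  - by apply/measurable_EFinP; exact: measurable_funM.
  - apply: filterS ag => x gx _; congr EFin; rewrite /v indicE.
    have [xB|xB] := boolP (x \in B); last by rewrite mulr0.
    by rewrite gx ?mul0r//; exact: set_mem.
split => // f If; have mf := il_meas I If.
apply/L1_memP; split; first exact: measurable_funM.
(* Truncating [|f|] makes [u n] order bounded, and the sign of [g] turns [g * u n] into [|g| * m n];
   the factor [v] drops out since [g] vanishes off [B]. The integrals are at most [nrm f], and
   monotone convergence removes the truncation. *)
pose m n x := Num.min `|f x| n%:R.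
have mm n : measurable_fun setT (m n).
  by apply: measurable_minr => //; exact: measurable_normr.
have m_ge0 n x : 0 <= m n x by rewrite le_min normr_ge0 ler0n.
pose u n x := Num.sg (g x) * m n x * v x.
have Zu n : Z (u n).
  apply: order_boundedM => //; split.
    by apply: measurable_funM => //; exact: measurable_sgr.
  exists n%:R => x; rewrite normrM (ger0_norm (m_ge0 _ _)).
  rewrite -[leRHS]mul1r ler_pM//; last by rewrite ge_min lexx orbT.
  by rewrite normr_sg; case: (_ == _).
have guE n x : g x * u n x = `|g x| * m n x.
  rewrite /u; have [xB|xB] := boolP (x \in B).
    by rewrite /v indicE xB mulr1 mulrA (normrEsg (g x)) [g x * _]mulrC.
  rewrite g0 ?mul0r ?normr0 ?mul0r//.
  by rewrite /v indicE (negbTE xB).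
have un n : (\int[mu]_x (`|g x| * m n x)%:E <= nrm f)%E.
  have [Lgu Igu] := gF _ (Zu n).
  have -> : (\int[mu]_x (`|g x| * m n x)%:E = (F (u n))%:E)%E.
    rewrite -Igu /Rintegral fineK; last exact: integrable_fin_num.
    by apply: eq_integral => x _; rewrite guE.
  apply: (@le_trans _ _ (fine (nrm (u n)))%:E).
    by rewrite lee_fin; apply: le_trans (Fq _ (Zu n)) (q_le_nrm (Zu n)).
  rewrite fineK; last exact: (il_fin I (Zmem (Zu n))).
  apply: (il_solid I (Zu n).1 If _).2; apply: aeW => x.
  rewrite /u normrM (ger0_norm (v_ge0 x)) normrM (ger0_norm (m_ge0 n x)).
  rewrite -[leRHS]mulr1 -[in leRHS](mul1r `|f x|); apply: ler_pM => //.
  - by rewrite mulr_ge0.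
  - apply: ler_pM => //; last by rewrite ge_min lexx.
    by rewrite normr_sg; case: (_ == _).
  - by rewrite /v indicE; case: (_ \in _).
apply: (@le_lt_trans _ _ (nrm f)); last first.
  by rewrite -ge0_fin_numE ?(il_ge0 I)// (il_fin I).
have := @cvg_monotone_convergence _ _ _ mu _ measurableT
  (fun n x => (`|g x| * m n x)%:E).
have -> : (fun x => limn (fun n => (`|g x| * m n x)%:E)) = (fun x => (`|g x * f x|)%:E).
  apply/funext => x; apply/cvg_lim => //.
  apply: cvg_EFin; first exact: nearW.
  rewrite normrM; apply: cvgMr; apply: cvg_near_cst.
  exists (Num.trunc `|f x|).+1 => // n /= xn; apply/eqP; rewrite eq_le ge_min lexx/=.
  rewrite le_min lexx/=; apply: le_trans (ltW (truncnS_gt _)) _.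
  by rewrite ler_nat.
move=> cv; apply: (cvge_to_le (cv _ _ _)).
- move=> n; apply/measurable_EFinP; apply: measurable_funM => //.
  exact: measurable_normr.
- by move=> n x _; rewrite lee_fin mulr_ge0.
- move=> x _ i j ij; rewrite lee_fin ler_wpM2l// le_min ge_min lexx/=.
  by rewrite ge_min ler_nat ij orbT.
- exact: nearW.
Qed.

End KoetheDualSaturated.

Theorem kdual_saturated {d : measure_display} {T : measurableType d}
    {R : realType} (mu : {measure set T -> \bar R}) mem nrm :
  ideal_space mu mem nrm -> sigma_finite setT mu -> saturated mu mem ->
  saturated mu (kdual_mem mu mem).
Proof.
move=> I sf sat [A [mA A0 KA]].
have [B [mB BA Bfin B0 IB]] := exists_indicator_mem I sf sat mA A0.
have [g [Kg]] := kdual_nonzero_on I sf mB Bfin IB B0; apply.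
by apply: filterS (KA _ Kg) => x gx /BA.
Qed.

(** * Pi-products *)

Section PiProduct.
Context {d : measure_display} {T : measurableType d} {R : realType}.
Variable mu : {measure set T -> \bar R}.

(** Merges near-optimal representations of two functions into one of their sum, for the triangle
    inequality of the pi-norm. *)
Definition interleave {A : Type} (a b : nat -> A) (n : nat) : A :=
  if odd n then b n./2 else a n./2.

Lemma interleave_ind {A : Type} (P : A -> Prop) (a b : nat -> A) n :
  (forall n, P (a n)) -> (forall n, P (b n)) -> P (interleave a b n).
Proof. by rewrite /interleave; case: ifPn. Qed.

Lemma nneseries_interleave (a b : nat -> \bar R) :
  (forall n, 0 <= a n)%E -> (forall n, 0 <= b n)%E ->
  (\sum_(0 <= n <oo) interleave a b n =
   \sum_(0 <= n <oo) a n + \sum_(0 <= n <oo) b n)%E.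
Proof.
move=> a0 b0; have c0 n : (0 <= interleave a b n)%E.
  exact: (interleave_ind (P := fun x => (0 <= x)%E)).
have partial N : (\sum_(0 <= n < N.*2) interleave a b n =
    \sum_(0 <= n < N) (a n + b n))%E.
  elim: N => [|N IH]; first by rewrite !big_nil.
  rewrite doubleS !big_nat_recr//= IH /interleave /= odd_double /=.
  by rewrite uphalf_double doubleK addeA.
rewrite -nneseriesD//; apply/eqP; rewrite eq_le; apply/andP; split.
  apply: lime_le; first exact: is_cvg_nneseries.
  apply: nearW => N.
  have le1 : (\sum_(0 <= n < N) interleave a b n <=
      \sum_(0 <= n < N.*2) interleave a b n)%E.
    have NN : (N <= N.*2)%N by rewrite -addnn leq_addr.
    rewrite [leRHS](big_cat_nat (n := N))//=.
    by rewrite leeDl// sume_ge0.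
  apply: le_trans le1 _; rewrite partial.
  by apply: nneseries_lim_ge => n _ _; exact: adde_ge0.
apply: lime_le; first by apply: is_cvg_nneseries => n _ _; exact: adde_ge0.
by apply: nearW => N; rewrite -partial; exact: nneseries_lim_ge.
Qed.

Variables (memX memY : (T -> R) -> Prop) (nrmX nrmY : (T -> R) -> \bar R).
Hypotheses (IX : ideal_space mu memX nrmX) (IY : ideal_space mu memY nrmY).
Local Notation P := (pi_norm mu memX nrmX memY nrmY).

Let cost_ge0 f g : memX f -> memY g -> (0 <= nrmX f * nrmY g)%E.
Proof. by move=> Xf Yg; rewrite mule_ge0 ?(il_ge0 IX) ?(il_ge0 IY). Qed.

Lemma pi_norm_ge0 h : (0 <= P h)%E.
Proof.
apply: le_ereal_inf_tmp => _ [[f g] [/= fg _ _] <-].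
by apply: nneseries_ge0 => n _ _; apply: cost_ge0; case: (fg n).
Qed.

Lemma pi_norm_le (h : T -> R) (f g : nat -> T -> R) :
  (forall n, memX (f n) /\ memY (g n)) ->
  {ae mu, forall x, ((`|h x|)%:E <= \sum_(0 <= n <oo) (`|f n x * g n x|)%:E)%E} ->
  (P h <= \sum_(0 <= n <oo) (nrmX (f n) * nrmY (g n)))%E.
Proof.
move=> fg hfg; have [fin|inf] := ltP (\sum_(0 <= n <oo) (nrmX (f n) * nrmY (g n)))%E +oo%E.
  by apply: ereal_inf_lbound; exists (f, g).
by apply: le_trans inf; exact: leey.
Qed.

Lemma pi_norm_solid (h g : T -> R) : {ae mu, forall x, `|h x| <= `|g x|} ->
  (P h <= P g)%E.
Proof.
move=> hg; apply: ereal_inf_le_tmp => _ [fg [fg1 fg2 fg3] <-].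
exists fg => //; split => //; apply: filterS2 hg fg2 => x hgx.
by apply: le_trans; rewrite lee_fin.
Qed.

Let single {A : Type} (a b : A) n := if n is 0%N then a else b.

Let nneseries_single (a : \bar R) : (0 <= a)%E ->
  (\sum_(0 <= n <oo) single a 0 n = a)%E.
Proof.
move=> a0; rewrite nneseries_recl//; last by case.
rewrite (@eseries_cond _ _ xpredT 1) eseries0 ?adde0// => -[|n]//=.
Qed.

Lemma pi_normM y z : memX y -> memY z ->
  (P (fun x => (y x * z x)%R) <= nrmX y * nrmY z)%E.
Proof.
move=> Xy Yz.
pose f n x : R := single y (fun=> 0) n x; pose g n x : R := single z (fun=> 0) n x.
apply: le_trans (pi_norm_le (f := f) (g := g) _ _) _.
- by move=> [|n]; split => //; [exact: (il_mem0 IX)|exact: (il_mem0 IY)].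
- apply: aeW => x; rewrite -[leLHS]nneseries_single//.
  by apply: lee_nneseries => [[|n] _ _|[|n] _]//=; rewrite lee_fin.
rewrite -[leRHS]nneseries_single ?cost_ge0//.
apply: lee_nneseries => [n _ _|[|n] _] //=.
  case: n => [|n]; apply: cost_ge0 => //; first exact: (il_mem0 IX).
  exact: (il_mem0 IY).
by rewrite (il_norm0 IX) mul0e.
Qed.

Lemma pi_normD h k : (P (fun x => (h x + k x)%R) <= P h + P k)%E.
Proof.
have [Pfin|] := boolP ((P h < +oo) && (P k < +oo))%E; last first.
  rewrite negb_and -!leNgt !leye_eq => /orP[/eqP ->|/eqP ->].
    by rewrite addye ?leey// gt_eqF// (lt_le_trans _ (pi_norm_ge0 _)).
  by rewrite addey ?leey// gt_eqF// (lt_le_trans _ (pi_norm_ge0 _)).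
move: Pfin => /andP[ph pk].
have fh : P h \is a fin_num by rewrite ge0_fin_numE ?pi_norm_ge0.
have fk : P k \is a fin_num by rewrite ge0_fin_numE ?pi_norm_ge0.
apply/lee_addgt0Pr => e e0.
have e2 : 0 < e / 2 by rewrite divr_gt0.
have [_ [[f1 g1] [/= m1 a1 _] <-] h1] := lb_ereal_inf_adherent e2 fh.
have [_ [[f2 g2] [/= m2 a2 _] <-] h2] := lb_ereal_inf_adherent e2 fk.
apply: le_trans (pi_norm_le (f := interleave f1 f2) (g := interleave g1 g2) _ _) _.
- by move=> n; rewrite /interleave; case: ifPn.
- apply: filterS2 a1 a2 => x a1x a2x.
  rewrite (@eq_eseriesr _ _ (interleave (fun n => (`|f1 n x * g1 n x|)%:E)
      (fun n => (`|f2 n x * g2 n x|)%:E))); last first.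
    by move=> n _; rewrite /interleave; case: ifPn.
  rewrite nneseries_interleave//.
  apply: le_trans (leeD a1x a2x); rewrite -EFinD lee_fin; exact: ler_normD.
rewrite (@eq_eseriesr _ _ (interleave (fun n => nrmX (f1 n) * nrmY (g1 n))%E
    (fun n => nrmX (f2 n) * nrmY (g2 n))%E)); last first.
  by move=> n _; rewrite /interleave; case: ifPn.
rewrite nneseries_interleave; last 2 first.
- by move=> n; apply: cost_ge0; case: (m1 n).
- by move=> n; apply: cost_ge0; case: (m2 n).
apply: le_trans (leeD (ltW h1) (ltW h2)) _.
rewrite addeACA -EFinD -splitr.
exact: lexx.
Qed.

Lemma pi_normZ a h : (P (fun x => (a * h x)%R) <= `|a|%:E * P h)%E.
Proof.
have [->|a0] := eqVneq a 0.
  rewrite normr0 mul0e.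
  rewrite (_ : (fun x => 0 * h x) = fun=> 0 * 0); last first.
    by apply/funext => x; rewrite !mul0r.
  apply: le_trans (pi_normM (il_mem0 IX) (il_mem0 IY)) _.
  by rewrite (il_norm0 IX) mul0e.
rewrite -lee_pdivrMl ?normr_gt0//; apply: le_ereal_inf_tmp.
move=> _ [[f g] [/= m1 a1 _] <-]; rewrite lee_pdivrMl ?normr_gt0//.
apply: le_trans (pi_norm_le (f := fun n x => a * f n x) (g := g) _ _) _.
- by move=> n; split; [apply: (il_memZ IX)|]; case: (m1 n).
- apply: filterS a1 => x a1x.
  rewrite normrM EFinM; apply: le_trans (lee_wpmul2l _ a1x) _ => //.
  rewrite -nneseriesZl//; apply: lee_nneseries => [n _ _|n _] //.
  by rewrite -EFinM lee_fin -mulrA [leRHS]normrM.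
rewrite -nneseriesZl; last by move=> n _; apply: cost_ge0; case: (m1 n).
apply: lee_nneseries => [n _ _|n _].
  by apply: cost_ge0; [apply: (il_memZ IX)|]; case: (m1 n).
by rewrite (il_normZ IX) ?muleA//; case: (m1 n).
Qed.

(** The bound on single products is summed along a representation of [h], integrating the dominating
    series term by term, and the infimum is taken over all representations. *)
Lemma absint_le_pi_norm (w h : T -> R) (C : R) : 0 < C ->
  measurable_fun setT w -> measurable_fun setT h ->
  (forall y z, memX y -> memY z ->
    (\int[mu]_x (`|w x * (y x * z x)|)%:E <= C%:E * (nrmX y * nrmY z))%E) ->
  (\int[mu]_x (`|w x * h x|)%:E <= C%:E * P h)%E.
Proof.
move=> C0 mw mh wC; rewrite -lee_pdivrMl//; apply: le_ereal_inf_tmp.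
move=> _ [[f g] [/= m1 a1 _] <-]; rewrite lee_pdivrMl//.
have mfg n : measurable_fun setT (fun x => w x * (f n x * g n x)).
  apply: measurable_funM => //; apply: measurable_funM.
    exact: (il_meas IX (m1 n).1).
  exact: (il_meas IY (m1 n).2).
apply: (@le_trans _ _ (\int[mu]_x
    (\sum_(0 <= n <oo) (`|w x * (f n x * g n x)|)%:E))%E).
  apply: ae_ge0_le_integral => //.
  - exact/measurable_abs_EFin/measurable_funM.
  - by move=> x _; apply: nneseries_ge0 => n _ _; rewrite lee_fin.
  - apply: (@ge0_emeasurable_sum _ _ _ _ (fun n x => (`|w x * (f n x * g n x)|)%:E) xpredT) => //.
    by move=> n _; exact: measurable_abs_EFin.
  - apply: filterS a1 => x a1x _; rewrite normrM EFinM.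
    apply: le_trans (lee_wpmul2l _ a1x) _ => //.
    rewrite -nneseriesZl//; apply: lee_nneseries => [n _ _|n _] //.
    by rewrite -EFinM lee_fin [leRHS]normrM.
rewrite integral_nneseries//; last by move=> n; exact: measurable_abs_EFin.
rewrite -nneseriesZl; last by move=> n _; apply: cost_ge0; case: (m1 n).
apply: lee_nneseries => [n _ _|n _]; first exact: absint_ge0.
by apply: wC; case: (m1 n).
Qed.

End PiProduct.

(** * Functionals on the pi-product and their densities *)

Section PiDual.
Context {d : measure_display} {T : measurableType d} {R : realType}.
Variable mu : {measure set T -> \bar R}.
Variables (memX memY : (T -> R) -> Prop) (nrmX nrmY : (T -> R) -> \bar R).
Hypotheses (IX : ideal_space mu memX nrmX) (IY : ideal_space mu memY nrmY).
Local Notation P := (pi_norm mu memX nrmX memY nrmY).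

Lemma sigma_oc_indic mem nrm (A : nat -> set T) y : ideal_space mu mem nrm ->
  sigma_oc mu mem nrm -> (forall n, measurable (A n)) ->
  (forall n, A n.+1 `<=` A n) -> \bigcap_n A n = set0 -> mem y ->
  (fun n => nrm (fun x => \1_(A n) x * `|y x|)) @ \oo --> 0%E.
Proof.
move=> I oc mA nA A0 Iy; apply: oc => [n|].
  apply: (il_solid I _ Iy _).1.
    apply: measurable_funM; first exact: measurable_indic.
    exact/measurable_normr/(il_meas I).
  apply: aeW => x; rewrite normrM normr_id indicE.
  by case: (_ \in _); rewrite ?normr1 ?normr0 ?mul1r ?mul0r.
apply: aeW => x; split=> [n|].
  rewrite !indicE ler_wpM2r//.
  have [xA|xA] := boolP (x \in A n.+1); last by case: (_ \in _).
  by rewrite (_ : x \in A n)//; apply/mem_set/nA/set_mem.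
have [N AN] : exists N, ~ A N x.
  apply: contrapT => /forallNP h; have : (\bigcap_n A n) x.
    by move=> n _; apply: contrapT; exact: h.
  by rewrite A0.
apply: cvg_near_cst; exists N => // n /= Nn; rewrite indicE memNset ?mul0r//.
move=> An; apply: AN; move: An; rewrite -(subnKC Nn).
by elim: (n - N)%N => [|k IH]; rewrite ?addn0// addnS => /nA.
Qed.

(** The indicator is moved to the factor whose norm is sigma-order continuous, while the norm of the
    other factor stays a constant. *)
Lemma pi_norm_tail (A : nat -> set T) y z :
  sigma_oc mu memX nrmX \/ sigma_oc mu memY nrmY ->
  (forall n, measurable (A n)) -> (forall n, A n.+1 `<=` A n) ->
  \bigcap_n A n = set0 -> memX y -> memY z ->
  (fun n => P (fun x => \1_(A n) x * (y x * z x))) @ \oo --> 0%E.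
Proof.
move=> oc mA nA A0 Xy Yz.
have cut mem nrm n w : ideal_space mu mem nrm -> mem w ->
    mem (fun x => \1_(A n) x * `|w x|).
  move=> I Iw; apply: (il_solid I _ Iw _).1.
    apply: measurable_funM; first exact: measurable_indic.
    exact/measurable_normr/(il_meas I).
  apply: aeW => x; rewrite normrM normr_id indicE.
  by case: (_ \in _); rewrite ?normr1 ?normr0 ?mul1r ?mul0r.
case: oc => oc.
  apply: (@squeeze_cvge _ _ _ _ (cst 0%E) _
      (fun n => nrmX (fun x => (\1_(A n) x * `|y x|)%R) * nrmY z)%E).
  - apply: nearW => n; rewrite (pi_norm_ge0 IX IY)/=.
    apply: le_trans (pi_normM IX IY (cut _ _ n _ IX Xy) Yz).
    by apply: pi_norm_solid; apply: aeW => x; rewrite mulrA !normrM normr_id.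
  - exact: cvg_cst.
  - rewrite -(mul0e (nrmY z)); apply: cvgeZr; first exact: (il_fin IY).
    exact: sigma_oc_indic IX oc mA nA A0 Xy.
apply: (@squeeze_cvge _ _ _ _ (cst 0%E) _
    (fun n => nrmX y * nrmY (fun x => (\1_(A n) x * `|z x|)%R))%E).
- apply: nearW => n; rewrite (pi_norm_ge0 IX IY)/=.
  apply: le_trans (pi_normM IX IY Xy (cut _ _ n _ IY Yz)).
  by apply: pi_norm_solid; apply: aeW => x; rewrite mulrCA !normrM normr_id.
- exact: cvg_cst.
- rewrite -(mule0 (nrmX y)); apply: cvgeZl; first exact: (il_fin IX).
  exact: sigma_oc_indic IY oc mA nA A0 Yz.
Qed.

Definition pi_space : set (T -> R) :=
  [set h | measurable_fun setT h /\ (P h < +oo)%E].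

Lemma pi_space_fin h : pi_space h -> P h \is a fin_num.
Proof. by move=> [_ h1]; rewrite ge0_fin_numE ?(pi_norm_ge0 IX IY). Qed.

Lemma pi_spaceD f g : pi_space f -> pi_space g -> pi_space (fun x => f x + g x).
Proof.
move=> [mf Pf] [mg Pg]; split; first exact: measurable_funD.
by apply: le_lt_trans (pi_normD IX IY _ _) _; rewrite lte_add_pinfty.
Qed.

Lemma pi_spaceZ a f : pi_space f -> pi_space (fun x => a * f x).
Proof.
move=> Zf; have [mf Pf] := Zf; split; first exact: measurable_funM.
apply: le_lt_trans (pi_normZ IX IY _ _) _.
by rewrite -(fineK (pi_space_fin Zf)) -EFinM ltry.
Qed.

Lemma pi_spaceM y z : memX y -> memY z -> pi_space (fun x => y x * z x).
Proof.
move=> Xy Yz; split.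
  by apply: measurable_funM; [exact: (il_meas IX)|exact: (il_meas IY)].
apply: le_lt_trans (pi_normM IX IY Xy Yz) _.
by rewrite -(fineK (il_fin IX Xy)) -(fineK (il_fin IY Yz)) -EFinM ltry.
Qed.

Lemma pi_space0 : pi_space (fun=> 0).
Proof.
have := pi_spaceZ 0 (pi_spaceM (il_mem0 IX) (il_mem0 IY)).
by under eq_fun do rewrite mul0r.
Qed.

Lemma pi_space_solid (f g : T -> R) : measurable_fun setT f -> pi_space g ->
  {ae mu, forall x, `|f x| <= `|g x|} ->
  pi_space f /\ fine (P f) <= fine (P g).
Proof.
move=> mf Zg fg; have le := @pi_norm_solid _ _ _ mu memX memY nrmX nrmY _ _ fg.
have Zf : pi_space f by split => //; apply: le_lt_trans le Zg.2.
by split => //; apply: fine_le => //; exact: pi_space_fin.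
Qed.

(** The density comes from the order ideal of the product [v] of two weak units. Not every product
    [y * z] is order bounded by [v], so the identity is proved on truncations and passed to the
    limit. *)
Lemma pi_dual_representation (F : (T -> R) -> R) (C : R) :
  sigma_finite setT mu -> saturated mu memX -> saturated mu memY ->
  sigma_oc mu memX nrmX \/ sigma_oc mu memY nrmY -> 0 <= C ->
  (forall f g, pi_space f -> pi_space g ->
    F (fun x => f x + g x) = F f + F g) ->
  (forall a f, pi_space f -> F (fun x => a * f x) = a * F f) ->
  (forall f, pi_space f -> F f <= C * fine (P f)) ->
  exists2 g : T -> R, measurable_fun setT g &
    forall y z, memX y -> memY z ->
      L1_mem mu (fun x => g x * (y x * z x)) /\
      \int[mu]_x (g x * (y x * z x)) = F (fun x => y x * z x).
Proof.
move=> sf satX satY oc C0 FD FZ FC.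
have [y0 Xy0 y0_gt0] := weak_unit IX sf satX.
have [z0 Yz0 z0_gt0] := weak_unit IY sf satY.
pose v x := y0 x * z0 x.
have Zv : pi_space v by exact: pi_spaceM.
have mv := Zv.1.
have v_gt0 x : 0 < v x by rewrite mulr_gt0.
have v_ge0 x : 0 <= v x by exact: ltW.
have obZ u : order_bounded v u -> pi_space u.
  move=> [mu' [c uc]]; apply: (pi_space_solid mu' (pi_spaceZ c Zv) _).1.
  by apply: aeW => x; apply: le_trans (uc x) (ler_norm _).
have absF f : pi_space f -> `|F f| <= C * fine (P f).
  move=> Zf; rewrite ler_norml FC// andbT lerNl -mulN1r -FZ//.
  apply: le_trans (FC _ (pi_spaceZ _ Zf)) _; apply: ler_wpM2l => //.
  apply: (pi_space_solid (pi_spaceZ _ Zf).1 Zf _).2.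
  by apply: aeW => x; rewrite mulN1r normrN.
have tail (A : nat -> set T) y z : (forall n, measurable (A n)) ->
    (forall n, A n.+1 `<=` A n) -> \bigcap_n A n = set0 -> memX y -> memY z ->
    (fun n => F (fun x => \1_(A n) x * (y x * z x))) @ \oo --> (0 : R).
  move=> mA nA A0 Xy Yz.
  have := pi_norm_tail oc mA nA A0 Xy Yz => /fine_cvg cv.
  apply/cvgr0Pnorm_lt => e e0.
  have e1 : 0 < e / (C + 1) by rewrite divr_gt0//; lra.
  have [N HN] := cvg0_lt cv e1; exists N => // n /= /HN /= h.
  have Zn : pi_space (fun x => \1_(A n) x * (y x * z x)).
    apply: (pi_space_solid _ (pi_spaceM Xy Yz) _).1.
      apply: measurable_funM; first exact: measurable_indic.
      exact: (pi_spaceM Xy Yz).1.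
    apply: aeW => x; rewrite normrM indicE.
    by case: (_ \in _); rewrite ?normr1 ?normr0 ?mul1r ?mul0r.
  apply: le_lt_trans (absF _ Zn) _.
  have p0 : 0 <= fine (P (fun x => \1_(A n) x * (y x * z x))).
    by rewrite fine_ge0// (pi_norm_ge0 IX IY).
  move: h; rewrite ger0_norm// ltr_pdivlMr; last by lra.
  by rewrite mulrDr mulr1 mulrC; apply: le_lt_trans; lra.
have [||||g [mg _ gF]] :=
    @functional_representation _ _ _ mu v F mv v_ge0 _ _ _ _ sf.
- by move=> f g obf obg; apply: FD; exact: obZ.
- by move=> a f obf; apply: FZ; exact: obZ.
- exists (C * fine (P v)) => e u e0 obu ue.
  apply: le_trans (absF _ (obZ _ obu)) _; rewrite mulrCA ler_wpM2l//.
  have Zev := pi_spaceZ e Zv.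
  apply: (@le_trans _ _ (fine (P (fun x => e * v x)))).
    apply: (pi_space_solid obu.1 Zev _).2; apply: filterS ue => x ux.
    by rewrite [leRHS]ger0_norm// mulr_ge0.
  rewrite -lee_fin EFinM !fineK; try exact: pi_space_fin.
  by have := pi_normZ IX IY e v; rewrite ger0_norm.
- by move=> A mA nA A0; exact: tail.
exists g => // y z Xy Yz; pose f x := y x * z x.
have Zf : pi_space f by exact: pi_spaceM.
have mf := Zf.1.
(* These sets exhaust the space because [v] is positive everywhere. On the truncations of [f], the
   values of [F] converge by [tail] on the complements, and the integrals by dominated convergence
   once [g * f] is known to be integrable. *)
pose A n := [set x | `|f x| <= n%:R * v x].
have mA n : measurable (A n).
  rewrite -[X in measurable X]setTI; apply: measurable_fun_le => //.
    exact: measurable_normr.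
  exact: measurable_funM.
have nA i j : (i <= j)%N -> A i `<=` A j.
  by move=> ij x /= /le_trans; apply; rewrite ler_wpM2r// ler_nat.
have xA x : exists N, forall n, (N <= n)%N -> x \in A n.
  exists (Num.trunc (`|f x| / v x)).+1 => n Nn; apply/mem_set/(nA _ _ Nn).
  by rewrite /A /= -ler_pdivrMr// ltW// truncnS_gt.
have obA n (w : T -> R) : measurable_fun setT w -> (forall x, `|w x| <= 1) ->
    order_bounded v (fun x => \1_(A n) x * (w x * f x)).
  move=> mw w1; split.
    by apply: measurable_funM; [exact: measurable_indic|exact: measurable_funM].
  exists n%:R => x; rewrite indicE; have [xAn|xAn] := boolP (x \in A n).
    rewrite mul1r normrM; apply: le_trans (set_mem xAn).
    by rewrite ler_piMl.
  by rewrite mul0r normr0 mulr_ge0.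
have cvA (c : R) x : (fun n => \1_(A n) x * c) @ \oo --> c.
  have [N HN] := xA x; apply: cvg_near_cst; exists N => // n /= /HN.
  by rewrite indicE => ->; rewrite mul1r.
have Lgf : L1_mem mu (fun x => g x * f x).
  apply/L1_memP; split; first exact: measurable_funM.
  apply: (@le_lt_trans _ _ (C * fine (P f))%:E); last exact: ltry.
  (* Testing [F] on [s * f] cut to [A n] bounds the integral of [|g * f|] over [A n] by [C * P f],
     uniformly in [n]. *)
  pose s x := Num.sg (g x) * Num.sg (f x).
  have ms : measurable_fun setT s.
    by apply: measurable_funM; exact: measurable_sgr.
  have s1 x : `|s x| <= 1.
    by rewrite normrM !normr_sg; do 2 case: (_ == _); rewrite ?mulr0 ?mul0r ?mulr1.
  have le n : (\int[mu]_x (\1_(A n) x * `|g x * f x|)%:E <= (C * fine (P f))%:E)%E.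
    have ob := obA n _ ms s1; have [Lu Iu] := gF _ ob.
    have <- : (F (fun x => \1_(A n) x * (s x * f x)))%:E =
        (\int[mu]_x (\1_(A n) x * `|g x * f x|)%:E)%E.
      rewrite -Iu /Rintegral fineK; last exact: integrable_fin_num.
      apply: eq_integral => x _; congr EFin.
      by rewrite normrM (normrEsg (g x)) (normrEsg (f x)) /s; ring.
    rewrite lee_fin; apply: le_trans (FC _ (obZ _ ob)) _; rewrite ler_wpM2l//.
    apply: (pi_space_solid ob.1 Zf _).2; apply: aeW => x.
    rewrite normrM (normrM (s x)) mulrA ler_piMl// mulr_ile1 ?s1//.
    by rewrite indicE; case: (_ \in _); rewrite ?normr1 ?normr0.
  have := @cvg_monotone_convergence _ _ _ mu _ measurableT
    (fun n x => (\1_(A n) x * `|g x * f x|)%:E).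
  have -> : (fun x => limn (fun n => (\1_(A n) x * `|g x * f x|)%:E)) =
      fun x => (`|g x * f x|)%:E.
    apply/funext => x; apply/cvg_lim => //.
    by apply: cvg_EFin; [exact: nearW|exact: cvA].
  move=> cv; apply: (cvge_to_le (cv _ _ _)).
  - move=> n; apply/measurable_EFinP; apply: measurable_funM.
      exact: measurable_indic.
    by apply: measurable_normr; exact: measurable_funM.
  - by move=> n x _; rewrite lee_fin mulr_ge0// indicE.
  - move=> x _ i j ij; rewrite lee_fin ler_wpM2r// !indicE.
    have [xi|xi] := boolP (x \in A i); last by rewrite ler0n.
    by rewrite (_ : x \in A j)//; apply/mem_set/(nA _ _ ij)/set_mem.
  - exact: nearW.
split => //.
have ob1 n : order_bounded v (fun x => \1_(A n) x * f x).
  have := obA n (cst 1) (measurable_cst _); under eq_fun do rewrite mul1r.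
  by apply => x; rewrite normr1.
have lim1 : (fun n => F (fun x => \1_(A n) x * f x)) @ \oo --> F f.
  have E n : F (fun x => \1_(A n) x * f x) =
      F f - F (fun x => \1_(~` A n) x * f x).
    have Zc : pi_space (fun x => \1_(~` A n) x * f x).
      apply: (pi_space_solid _ Zf _).1.
        by apply: measurable_funM => //; apply: measurable_indic; exact: measurableC.
      apply: aeW => x; rewrite normrM indicE.
      by case: (_ \in _); rewrite ?normr1 ?normr0 ?mul1r ?mul0r.
    apply/eqP; rewrite eq_sym subr_eq -FD//; last exact: obZ.
    apply/eqP; congr F; apply/funext => x; rewrite -mulrDl !indicE in_setC.
    by case: (x \in A n); rewrite ?addr0 ?add0r mul1r.
  rewrite (funext E) -[F f in X in _ --> X]subr0.
  apply: cvgB; first exact: cvg_cst.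
  apply: tail => //.
  - by move=> n; exact: measurableC.
  - by move=> n; apply: subsetC; exact: nA.
  - rewrite -subset0 => x h; have [N /(_ N (leqnn N))] := xA x.
    by move=> /set_mem; exact: (h N Logic.I).
have lim2 : (fun n => F (fun x => \1_(A n) x * f x)) @ \oo -->
    \int[mu]_x (g x * f x).
  have [||||_ _ cv] := @dominated_convergence _ _ _ mu _ measurableT
      (fun n x => (g x * (\1_(A n) x * f x))%:E) (fun x => (g x * f x)%:E)
      (fun x => (`|g x * f x|)%:E) _ _ _ (L1_mem_norm Lgf).
  - move=> n; apply/measurable_EFinP; apply: measurable_funM => //.
    exact: (ob1 n).1.
  - by apply/measurable_EFinP; exact: measurable_funM.
  - apply: aeW => x _; apply: cvg_EFin; first exact: nearW.
    under eq_fun do rewrite mulrCA.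
    exact: cvA.
  - apply: aeW => x n _; rewrite lee_fin mulrCA normrM ler_piMl//.
    by rewrite indicE; case: (_ \in _); rewrite ?normr1 ?normr0.
  have cv' : (fun n => \int[mu]_x (g x * (\1_(A n) x * f x))%:E)%E @ \oo -->
      (\int[mu]_x (g x * f x))%:E.
    by rewrite /Rintegral fineK//; exact: integrable_fin_num.
  have E : (fun n => F (fun x => \1_(A n) x * f x)) =
      fine \o (fun n => \int[mu]_x (g x * (\1_(A n) x * f x))%:E)%E.
    by apply/funext => n; rewrite /= -(gF _ (ob1 n)).2.
  by rewrite E; exact: fine_cvg cv'.
exact: (cvg_unique _ lim2 lim1).
Qed.

End PiDual.

Section FiniteSums.
Context {R : realType}.

(** Square ranges need a single size; combinations of different sizes are added after padding with
    zeros through [dsum_widen]. *)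
Definition dsum n (F : nat -> nat -> R) := \sum_(i < n) \sum_(j < n) F i j.

Lemma dsumD n F G : dsum n (fun i j => F i j + G i j) = dsum n F + dsum n G.
Proof. by rewrite -big_split; apply: eq_bigr => i _; rewrite -big_split. Qed.

Lemma dsumZ n a F : dsum n (fun i j => a * F i j) = a * dsum n F.
Proof. by rewrite mulr_sumr; apply: eq_bigr => i _; rewrite mulr_sumr. Qed.

Lemma dsum_widen n m F : (n <= m)%N ->
  dsum n F = dsum m (fun i j => if (i < n)%N && (j < n)%N then F i j else 0).
Proof.
move=> nm; rewrite /dsum (big_ord_widen m (fun i => \sum_(j < n) F i j))//.
rewrite big_mkcond; apply: eq_bigr => i _; case: ifPn => _.
  by rewrite (big_ord_widen m (F i))// big_mkcond.
by rewrite big1.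
Qed.

Lemma eq_dsum n F G : (forall i j, (i < n)%N -> (j < n)%N -> F i j = G i j) ->
  dsum n F = dsum n G.
Proof. by move=> FG; apply: eq_bigr => i _; apply: eq_bigr => j _; exact: FG. Qed.

Lemma le_dsum n F i j : (forall i j, 0 <= F i j) -> (i < n)%N -> (j < n)%N ->
  F i j <= dsum n F.
Proof.
move=> F0 ni nj; rewrite /dsum (bigD1 (Ordinal ni))//= (bigD1 (Ordinal nj))//=.
by rewrite -addrA lerDl addr_ge0// sumr_ge0// => k _; exact: sumr_ge0.
Qed.

Lemma dsum_delta n F i j : (i < n)%N -> (j < n)%N ->
  dsum n (fun k l => ((k == i) && (l == j))%:R * F k l) = F i j.
Proof.
move=> ni nj; rewrite /dsum (bigD1 (Ordinal ni))//= (bigD1 (Ordinal nj))//=.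
rewrite !eqxx mul1r big1 ?addr0 => [|l]; last first.
  by rewrite -val_eqE /= => /negbTE ->; rewrite mul0r.
rewrite big1 ?addr0// => k; rewrite -val_eqE /= => /negbTE ->.
by rewrite big1// => l _; rewrite mul0r.
Qed.

Lemma sum_norm_disjoint n (a : nat -> R) :
  (forall i j, i <> j -> a i = 0 \/ a j = 0) ->
  \sum_(i < n) `|a i| = `|\sum_(i < n) a i|.
Proof.
move=> aa; elim: n => [|n IH]; first by rewrite !big_ord0 normr0.
rewrite !big_ord_recr /= IH; have [an|an] := eqVneq (a n) 0.
  by rewrite an normr0 !addr0.
suff -> : \sum_(i < n) a i = 0 by rewrite normr0 !add0r.
apply: big1 => i _; have ne : (i : nat) <> n.
  by move=> h; have := ltn_ord i; rewrite h ltnn.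
by have [//|a0] := aa i n ne; rewrite a0 eqxx in an.
Qed.

End FiniteSums.

(** * Bounded multipliers and annihilators of a basis *)

Section Multipliers.
Context {d : measure_display} {T : measurableType d} {R : realType}.
Variable mu : {measure set T -> \bar R}.
Implicit Types (mem : (T -> R) -> Prop) (nrm : (T -> R) -> \bar R).

Lemma L1_mem_sum n (F : nat -> T -> R) : (forall i, L1_mem mu (F i)) ->
  L1_mem mu (fun x => \sum_(i < n) F i x) /\
  \int[mu]_x (\sum_(i < n) F i x) = \sum_(i < n) \int[mu]_x F i x.
Proof.
move=> LF; elim: n => [|n [IH1 IH2]].
  rewrite (_ : (fun _ => _) = cst 0); last by apply/funext => x; rewrite big_ord0.
  rewrite big_ord0 /=; split; first exact: integrable0.
  by rewrite Rintegral_cst// mul0r.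
rewrite big_ord_recr /= -IH2 -(RintegralD measurableT IH1 (LF n)).
rewrite (_ : (fun x => \sum_(i < n.+1) F i x) =
    fun x => \sum_(i < n) F i x + F n x).
  by split => //; exact: L1_memD.
by apply/funext => x; rewrite big_ord_recr.
Qed.

Lemma mulsp_bounded mem1 nrm1 mem2 nrm2 (h : T -> R) :
  ideal_space mu mem1 nrm1 -> ideal_space mu mem2 nrm2 ->
  mulsp_mem mem1 mem2 h -> exists2 K : R, 0 < K &
    forall f, mem1 f -> (nrm2 (fun x => (h x * f x)%R) <= K%:E * nrm1 f)%E.
Proof.
move=> I1 I2 [mh hM]; apply: (il_bounded I1 (Phi := fun f => nrm2 (fun x => h x * f x))).
- by move=> f If; apply: (il_fin I2); exact: hM.
- move=> f g If Ig fg; apply: (il_solid I2 _ (hM _ Ig) _).2.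
    by apply: measurable_funM => //; exact: (il_meas I1).
  by apply: filterS fg => x fgx; rewrite !normrM ler_wpM2l.
- move=> a f If; rewrite -(il_normZ I2); last exact: hM.
  by congr nrm2; apply/funext => x; rewrite mulrCA.
Qed.

Lemma mulsp_kdual_bounded memX nrmX memW nrmW (g : T -> R) :
  sigma_finite setT mu -> saturated mu memW ->
  ideal_space mu memX nrmX -> ideal_space mu memW nrmW ->
  mulsp_mem memX (kdual_mem mu memW) g -> exists2 K : R, 0 < K &
    forall y z, memX y -> memW z ->
      (\int[mu]_x (`|g x * (y x * z x)|)%:E <= K%:E * (nrmX y * nrmW z))%E.
Proof.
move=> sf sat IX IW gM.
have [K K0 HK] := mulsp_bounded IX (kdual_ideal_space IW sf sat) gM.
exists K => // y z Xy Wz.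
under eq_integral do rewrite mulrA.
apply: le_trans (hoelder_kdual IW (gM.2 _ Xy) Wz) _; rewrite muleA.
by apply: lee_wpmul2r; [exact: (il_ge0 IW)|exact: HK].
Qed.

Lemma il_mem_sum mem nrm n (F : nat -> T -> R) : ideal_space mu mem nrm ->
  (forall i, mem (F i)) -> mem (fun x => \sum_(i < n) F i x).
Proof.
move=> I IF; elim: n => [|n IH].
  rewrite (_ : (fun _ => _) = fun=> 0); first exact: (il_mem0 I).
  by apply/funext => x; rewrite big_ord0.
rewrite (_ : (fun _ => _) = fun x => \sum_(i < n) F i x + F n x).
  exact: (il_memD I).
by apply/funext => x; rewrite big_ord_recr.
Qed.

(** By Hoelder, integration against [w] is continuous, so it vanishes on the whole space along with
    the partial sums. Testing with the sign of [w] times a weak unit then gives [w = 0] a.e. *)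
Lemma schauder_annihilator memW nrmW (b : nat -> T -> R) (w : T -> R) :
  ideal_space mu memW nrmW -> sigma_finite setT mu -> saturated mu memW ->
  schauder_basis memW nrmW b -> kdual_mem mu memW w ->
  (forall i, \int[mu]_x (w x * b i x) = 0) -> {ae mu, forall x, w x = 0}.
Proof.
move=> IW sf sat [Wb basis] Kw wb; have [mw wL1] := Kw.
have w0 z : memW z -> \int[mu]_x (w x * z x) = 0.
  move=> Wz; have [a [acv _]] := basis z Wz.
  pose s N x := \sum_(k < N) a k * b k x.
  have Ws N : memW (s N).
    apply: (@il_mem_sum _ _ N (fun k x => a k * b k x) IW) => k.
    exact: (il_memZ IW).
  have sE N : (fun x => w x * s N x) = fun x => \sum_(k < N) a k * (w x * b k x).
    by apply/funext => x; rewrite mulr_sumr; apply: eq_bigr => k _; rewrite mulrCA.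
  have s0 N : \int[mu]_x (w x * s N x) = 0.
    rewrite sE (@L1_mem_sum N (fun k x => a k * (w x * b k x)) _).2; last first.
      by move=> k; apply: L1_memZ; exact: wL1.
    by apply: big1 => k _; rewrite RintegralZl ?wb ?mulr0//; exact: wL1.
  apply: contrapT => /eqP; rewrite -normr_gt0 => z0.
  set c := `|_| in z0; pose KN := fine (kdual_norm mu memW nrmW w).
  have KN0 : 0 <= KN by rewrite fine_ge0// (kdual_norm_ge0 IW).
  have e0 : 0 < c / (KN + 1) by rewrite divr_gt0//; lra.
  have [N /(_ N (leqnn N))] := cvge0_lt acv e0.
  have Wzs : memW (fun x => z x - s N x) by exact: (il_memB IW).
  rewrite -/(s N) -(fineK (il_fin IW Wzs)) lte_fin => hN.
  have : c <= KN * fine (nrmW (fun x => z x - s N x)).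
    have -> : c = `|\int[mu]_x (w x * (z x - s N x))|.
      under eq_Rintegral do rewrite mulrBr.
      by rewrite RintegralB// ?s0 ?subr0//; exact: wL1.
    apply: le_trans (le_normr_Rintegral measurableT (wL1 _ Wzs)) _.
    rewrite -lee_fin /Rintegral fineK; last first.
      by apply: integrable_fin_num => //; exact/L1_mem_norm/wL1.
    rewrite EFinM !fineK; first exact: hoelder_kdual.
      exact: (il_fin IW).
    exact: (kdual_norm_fin IW).
  apply/negP; rewrite -ltNge; move: hN; rewrite ltr_pdivlMr; last by lra.
  have : 0 <= fine (nrmW (fun x => z x - s N x)).
    by rewrite fine_ge0// (il_ge0 IW).
  set n := fine _; rewrite mulrDr mulr1 mulrC; lra.
have [z0 Wz0 z0_gt0] := weak_unit IW sf sat; have mz0 := il_meas IW Wz0.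
have Wz : memW (fun x => Num.sg (w x) * z0 x).
  apply: (il_solid IW _ Wz0 _).1.
    by apply: measurable_funM => //; exact: measurable_sgr.
  apply: aeW => x; rewrite normrM ler_piMl// normr_sg.
  by case: (_ == _).
have E x : w x * (Num.sg (w x) * z0 x) = `|w x| * z0 x.
  by rewrite normrEsg mulrA [w x * _]mulrC.
have := w0 _ Wz; under eq_Rintegral do rewrite E.
move=> i0.
have : (\int[mu]_x `|(w x * (Num.sg (w x) * z0 x))%:E| = 0)%E.
  have iE : (\int[mu]_x `|(w x * (Num.sg (w x) * z0 x))%:E| =
      \int[mu]_x (`|w x| * z0 x)%:E)%E.
    apply: eq_integral => x _; rewrite E gee0_abs// lee_fin.
    by rewrite mulr_ge0// ltW.
  rewrite iE -[LHS]fineK; first by rewrite -[X in X%:E]/(Rintegral _ _ _) i0.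
  apply: integrable_fin_num => //.
  have := wL1 _ Wz; apply: eq_integrable => // x _ /=.
  by rewrite E.
move/(ae_eq_integral_abs _ measurableT) => /(_ _) h.
have {}h := h (measurable_int _ (wL1 _ Wz)).
apply: filterS h => x /(_ Logic.I) /= [].
rewrite E => /eqP; rewrite mulf_eq0 normr_eq0 (gt_eqF (z0_gt0 x)) orbF.
by move/eqP.
Qed.

End Multipliers.

(** * A moment problem on the pi-product *)

Section PiInterpolation.
Context {d : measure_display} {T : measurableType d} {R : realType}.
Variable mu : {measure set T -> \bar R}.
Variables (memX memW : (T -> R) -> Prop) (nrmX nrmW : (T -> R) -> \bar R).
Hypotheses (IX : ideal_space mu memX nrmX) (IW : ideal_space mu memW nrmW).
Local Notation P := (pi_norm mu memX nrmX memW nrmW).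
Variables (a b : nat -> T -> R) (t : nat -> nat -> R).
Hypotheses (Xa : forall j, memX (a j)) (Wb : forall i, memW (b i)).

Let phi n (r : nat -> nat -> R) x := dsum n (fun i j => r i j * a j x * b i x).
Let tau n (r : nat -> nat -> R) := dsum n (fun i j => r i j * t i j).

Let pi_space_sum n (F : nat -> T -> R) :
  (forall i, pi_space mu memX memW nrmX nrmW (F i)) ->
  pi_space mu memX memW nrmX nrmW (fun x => \sum_(i < n) F i x).
Proof.
move=> IF; elim: n => [|n IH].
  rewrite (_ : (fun _ => _) = fun=> 0); first exact: (pi_space0 IX IW).
  by apply/funext => x; rewrite big_ord0.
rewrite (_ : (fun _ => _) = fun x => \sum_(i < n) F i x + F n x).
  exact: (pi_spaceD IX IW).
by apply/funext => x; rewrite big_ord_recr.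
Qed.

Let phi_mem n r : pi_space mu memX memW nrmX nrmW (phi n r).
Proof.
apply: (@pi_space_sum n (fun i x => \sum_(j < n) r i j * a j x * b i x)) => i.
apply: (@pi_space_sum n (fun j x => r i j * a j x * b i x)) => j.
rewrite (_ : (fun _ => _) = fun x => r i j * (a j x * b i x)).
  by apply: (pi_spaceZ IX IW); exact: (pi_spaceM IX IW).
by apply/funext => x; rewrite mulrA.
Qed.

(** The numbers [t i j] are prescribed moments of [g] against the products [a j * b i], and
    domination by the pi-norm is the solvability condition. Mazur-Orlicz extends the moments to a
    functional, and [pi_dual_representation] supplies its density. *)
Lemma pi_interpolation (C : R) : sigma_finite setT mu ->
  saturated mu memX -> saturated mu memW ->
  sigma_oc mu memX nrmX \/ sigma_oc mu memW nrmW -> 0 < C ->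
  (forall n (r : nat -> nat -> R), (forall i j, `|r i j| <= 1) ->
    ((dsum n (fun i j => r i j * t i j)%R)%:E <=
      C%:E * P (fun x => dsum n (fun i j => r i j * a j x * b i x)%R))%E) ->
  exists g : T -> R, [/\ measurable_fun setT g,
    forall y z, memX y -> memW z -> L1_mem mu (fun x => g x * (y x * z x)) &
    forall i j, \int[mu]_x (g x * (a j x * b i x)) = t i j].
Proof.
move=> sf satX satW oc C0 bound.
pose Z := pi_space mu memX memW nrmX nrmW.
pose p h := C * fine (P h).
have phiZ n s r : phi n (fun i j => s * r i j) = fun x => s * phi n r x.
  apply/funext => x; rewrite /phi -dsumZ; apply: eq_dsum => i j _ _.
  by rewrite !mulrA.
have tauZ n s r : tau n (fun i j => s * r i j) = s * tau n r.
  by rewrite /tau -dsumZ; apply: eq_dsum => i j _ _; rewrite !mulrA.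
have sp : sublinear_on Z p.
  split=> [f g Zf Zg|s f s0 Zf]; rewrite /p.
    rewrite -mulrDr ler_pM2l// -lee_fin EFinD !fineK; first exact: (pi_normD IX IW).
    - exact: (pi_space_fin IX IW).
    - exact: (pi_space_fin IX IW).
    - by apply: (pi_space_fin IX IW); exact: (pi_spaceD IX IW).
  rewrite mulrCA ler_pM2l// -lee_fin EFinM !fineK.
  - by have := pi_normZ IX IW s f; rewrite ger0_norm.
  - exact: (pi_space_fin IX IW).
  - by apply: (pi_space_fin IX IW); exact: (pi_spaceZ IX IW).
have tau_le n r : tau n r <= p (phi n r).
  (* Division by [s] brings the coefficients into the range where [bound] applies; homogeneity
     undoes it. The entries outside the summed square are set to 0 because [bound] constrains all of
     them. *)
  pose s := 1 + dsum n (fun i j => `|r i j|).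
  have s1 : 1 <= s by rewrite lerDl; apply: sumr_ge0 => i _; exact: sumr_ge0.
  have s0 : 0 < s by lra.
  pose r' i j := s^-1 * (if (i < n)%N && (j < n)%N then r i j else 0).
  have r'1 i j : `|r' i j| <= 1.
    rewrite normrM gtr0_norm ?invr_gt0// ler_pdivrMl// mulr1.
    case: ifPn => [/andP[ni nj]|_]; last by rewrite normr0 ltW.
    apply: (@le_trans _ _ (dsum n (fun i j => `|r i j|))); last by rewrite lerDr.
    exact: (@le_dsum _ n (fun i j => `|r i j|)).
  have r'E i j : (i < n)%N -> (j < n)%N -> r' i j = s^-1 * r i j.
    by rewrite /r' => -> ->.
  have tE : tau n r' = s^-1 * tau n r.
    by rewrite -tauZ; apply: eq_dsum => i j ni nj; rewrite r'E.
  have pE : phi n r' = fun x => s^-1 * phi n r x.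
    rewrite -phiZ; apply/funext => x; apply: eq_dsum => i j ni nj.
    by rewrite r'E.
  have := bound n r' r'1; rewrite -/(tau n r') -/(phi n r') tE pE.
  have Zs : Z (fun x => s^-1 * phi n r x) by exact: (pi_spaceZ IX IW).
  rewrite -(fineK (pi_space_fin IX IW Zs)) -EFinM lee_fin => h.
  have := sp.2 s^-1 (phi n r); rewrite invr_ge0 => /(_ (ltW s0) (phi_mem n r)).
  by move=> /(le_trans h); rewrite ler_pM2l// invr_gt0.
pose D : set ((T -> R) * R) := [set p | exists n r, p = (phi n r, tau n r)].
have [||||||||F [FD FZ Fp FDv]] := @mazur_orlicz_fun _ _ Z D p.
- exact: (pi_space0 IX IW).
- exact: (pi_spaceD IX IW).
- exact: (pi_spaceZ IX IW).
- exact: sp.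
- exists 0%N, (fun _ _ => 0); congr pair; last by rewrite /tau /dsum big_ord0.
  by apply/funext => x; rewrite /phi /dsum big_ord0.
- move=> _ _ [n1 [r1 ->]] [n2 [r2 ->]] /=.
  pose tr n (r : nat -> nat -> R) i j := if (i < n)%N && (j < n)%N then r i j else 0.
  exists (maxn n1 n2), (fun i j => tr n1 r1 i j + tr n2 r2 i j).
  have n1m := leq_maxl n1 n2; have n2m := leq_maxr n1 n2.
  congr pair.
    apply/funext => x; rewrite /phi (dsum_widen _ n1m) (dsum_widen _ n2m) -dsumD.
    apply: eq_dsum => i j _ _; rewrite /tr.
    by do 2 case: ifPn => _; rewrite ?mul0r ?addr0 ?add0r ?mul0r// !mulrDl.
  rewrite /tau (dsum_widen _ n1m) (dsum_widen _ n2m) -dsumD.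
  apply: eq_dsum => i j _ _; rewrite /tr.
  by do 2 case: ifPn => _; rewrite ?mul0r ?addr0 ?add0r ?mul0r// mulrDl.
- move=> s _ s0 [n [r ->]] /=; exists n, (fun i j => s * r i j).
  by rewrite phiZ tauZ.
- by move=> _ [n [r ->]] /=; split; [exact: phi_mem|exact: tau_le].
(* The lower bounds for [r] and for its opposite combine to an equality. *)
have Ftau n r : F (phi n r) = tau n r.
  apply/eqP; rewrite eq_le; apply/andP; split; last first.
    by have := FDv (phi n r, tau n r); apply; exists n, r.
  have := FDv (phi n (fun i j => -1 * r i j), tau n (fun i j => -1 * r i j)).
  rewrite /= phiZ tauZ FZ; last exact: phi_mem.
  rewrite !mulN1r lerN2; apply; exists n, (fun i j => -1 * r i j).
  by rewrite phiZ tauZ mulN1r.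
have [g mg gF] := pi_dual_representation IX IW sf satX satW oc (ltW C0) FD FZ Fp.
exists g; split => // [y z Xy Wz|i j]; first by case: (gF _ _ Xy Wz).
rewrite (gF _ _ (Xa j) (Wb i)).2.
pose n := (maxn i j).+1; pose r k l : R := ((k == i) && (l == j))%:R.
have ni : (i < n)%N by rewrite ltnS leq_maxl.
have nj : (j < n)%N by rewrite ltnS leq_maxr.
have <- : tau n r = t i j by exact: dsum_delta.
rewrite -Ftau; congr F; apply/funext => x.
rewrite /phi -[LHS](@dsum_delta _ n (fun k l => a l x * b k x) i j)//.
by apply: eq_dsum => k l _ _; rewrite mulrA.
Qed.

End PiInterpolation.

(** * Factorization *)

Section Operators.
Context {R : realType}.
Context {d1 : measure_display} {Om : measurableType d1}.
Context {d2 : measure_display} {De : measurableType d2}.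
Variables (mu : {measure set Om -> \bar R}) (nu : {measure set De -> \bar R}).

(** Absorbs [h] into the operator, so that [T] and [S] composed with multiplication by [h] are
    compared on the same space [X1]. *)
Lemma bdd_linop_mulsp (X1 X2 : BFS mu) (Y : BFS nu) S (h : Om -> R) :
  bdd_linop X2 Y S -> mulsp_mem (bfs_mem X1) (bfs_mem X2) h ->
  bdd_linop X1 Y (fun f => S (fun x => h x * f x)).
Proof.
move=> [SY Sae Slin [K SK]] hM; have [_ hX] := hM.
have [C C0 hC] := mulsp_bounded (bfs_ideal_space X1) (bfs_ideal_space X2) hM.
split.
- by move=> f Xf; exact/SY/hX.
- move=> f g Xf Xg fg; apply: Sae; [exact: hX..|].
  by apply: filterS fg => x ->.
- move=> a b f g Xf Xg; rewrite (_ : (fun x => h x * (a * f x + b * g x)) =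
      fun x => a * (h x * f x) + b * (h x * g x)).
    by apply: Slin; exact: hX.
  by apply/funext => x; ring.
exists (`|K| * C) => f Xf; apply: le_trans (SK _ (hX _ Xf)) _.
apply: (@le_trans _ _ (`|K| * bfs_norm X2 (fun x => h x * f x))).
  by rewrite ler_wpM2r ?ler_norm// bfs_norm_ge0//; exact: hX.
by rewrite -mulrA ler_wpM2l//; have := hC _ Xf; rewrite -EFinM lee_fin.
Qed.

Lemma bdd_linop_sub_sum (X : BFS mu) (Y : BFS nu) T f (a : nat -> R)
    (b : nat -> Om -> R) N :
  bdd_linop X Y T -> bfs_mem X f -> (forall k, bfs_mem X (b k)) ->
  {ae nu, forall y, T (fun x => f x - \sum_(k < N) a k * b k x) y =
    T f y - \sum_(k < N) a k * T (b k) y}.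
Proof.
move=> [TY Tae Tlin _] Xf Xb.
have Xs n : bfs_mem X (fun x => f x - \sum_(k < n) a k * b k x).
  apply: (il_memB (bfs_ideal_space X)) => //.
  apply: (@il_mem_sum _ _ _ mu _ _ n (fun k x => a k * b k x) (bfs_ideal_space X)) => k.
  exact: bfs_memZ.
elim: N => [|N IH].
  rewrite (_ : (fun x => _) = f).
    by apply: aeW => y; rewrite big_ord0 subr0.
  by apply/funext => x; rewrite big_ord0 subr0.
rewrite (_ : (fun x => _) =
    fun x => 1 * (f x - \sum_(k < N) a k * b k x) + (- a N) * b N x).
  have := Tlin 1 (- a N) _ _ (Xs N) (Xb N); apply: filterS2 IH => y IHy ->.
  by rewrite IHy big_ord_recr /=; ring.
by apply/funext => x; rewrite big_ord_recr /=; ring.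
Qed.

(* Along a subsequence the partial sums converge a.e. under both operators. *)
Lemma factorization_on_basis (X : BFS mu) (Y1 Y2 : BFS nu) T S
    (b : nat -> Om -> R) (g : De -> R) :
  bdd_linop X Y1 T -> bdd_linop X Y2 S ->
  schauder_basis (bfs_mem X) (bfs_enorm X) b ->
  (forall n, {ae nu, forall y, T (b n) y = g y * S (b n) y}) ->
  forall f, bfs_mem X f -> {ae nu, forall y, T f y = g y * S f y}.
Proof.
move=> hT hS [Xb basis] Tb f Xf.
have [TY _ _ [KT TK]] := hT; have [SY _ _ [KS SK]] := hS.
have [a [acv _]] := basis f Xf.
pose u N x := f x - \sum_(k < N) a k * b k x.
have Xu N : bfs_mem X (u N).
  apply: (il_memB (bfs_ideal_space X)) => //.
  apply: (@il_mem_sum _ _ _ mu _ _ N (fun k x => a k * b k x) (bfs_ideal_space X)) => k.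
  exact: bfs_memZ.
(* One constant for both operators, made positive by the 1, so that one subsequence sends both
   images of the remainder to 0 a.e. at the rate needed by [il_ae_cvg0]. *)
pose K := `|KT| + `|KS| + 1.
have K0 : 0 < K.
  by rewrite /K; have := normr_ge0 KT; have := normr_ge0 KS; lra.
have /choice[N HN] k : exists N, K * bfs_norm X (u N) <= (4^-1) ^+ k.
  have e0 : 0 < (4^-1 : R) ^+ k / K by rewrite divr_gt0// exprn_gt0// invr_gt0.
  have [N /(_ N (leqnn N))] := cvge0_lt acv e0.
  by rewrite lte_fin ltr_pdivlMr// mulrC => /ltW; exists N.
have small (Y : BFS nu) (Q : (Om -> R) -> De -> R) KQ :
    (forall f, bfs_mem X f -> bfs_mem Y (Q f)) ->
    (forall f, bfs_mem X f -> bfs_norm Y (Q f) <= KQ * bfs_norm X f) ->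
    KQ <= K ->
    {ae nu, forall y, (fun k => Q (u (N k)) y) @ \oo --> (0 : R)}.
  move=> QY QK KQK; apply: (il_ae_cvg0 (bfs_ideal_space Y)) => k.
    exact: QY.
  rewrite lee_fin; apply: le_trans (QK _ (Xu _)) _.
  apply: le_trans (HN k); rewrite ler_wpM2r//; exact: bfs_norm_ge0.
have cT : KT <= K.
  by rewrite /K; have := ler_norm KT; have := normr_ge0 KS; lra.
have cS : KS <= K.
  by rewrite /K; have := ler_norm KS; have := normr_ge0 KT; lra.
have T0 := small _ _ _ TY TK cT; have S0 := small _ _ _ SY SK cS.
have Tu := ae_foralln (fun k => bdd_linop_sub_sum a (N k) hT Xf Xb).
have Su := ae_foralln (fun k => bdd_linop_sub_sum a (N k) hS Xf Xb).
have {}Tb := ae_foralln Tb.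
near=> y.
have Ty : forall k, T (u (N k)) y = T f y - \sum_(j < N k) a j * T (b j) y.
  by near: y.
have Sy : forall k, S (u (N k)) y = S f y - \sum_(j < N k) a j * S (b j) y.
  by near: y.
have Tby : forall n, T (b n) y = g y * S (b n) y by near: y.
have T0y : (fun k => T (u (N k)) y) @ \oo --> (0 : R) by near: y.
have S0y : (fun k => S (u (N k)) y) @ \oo --> (0 : R) by near: y.
(* The basis terms cancel, so this sequence is constant in [k]; it also tends to 0. *)
have E : (fun k => T (u (N k)) y - g y * S (u (N k)) y) =
    (fun=> T f y - g y * S f y).
  apply/funext => k; rewrite Ty Sy mulrBr mulr_sumr.
  under eq_bigr do rewrite Tby mulrCA.
  by rewrite opprB addrA subrK.
have cv : (fun k => T (u (N k)) y - g y * S (u (N k)) y) @ \oo --> 0 - g y * (0 : R).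
  by apply: cvgB => //; exact: cvgMr.
rewrite mulr0 subr0 E in cv.
apply/eqP; rewrite -subr_eq0; apply/eqP.
exact: (cvg_unique _ (cvg_cst _) cv).
Unshelve. all: by end_near. Qed.

End Operators.

Section DoubleIntegrals.
Context {d : measure_display} {T : measurableType d} {R : realType}.
Variable mu : {measure set T -> \bar R}.

Lemma sum_sum_Rintegral n m (r : nat -> nat -> R) (w : T -> R)
    (F : nat -> nat -> T -> R) :
  (forall i j, L1_mem mu (fun x => w x * F i j x)) ->
  L1_mem mu (fun x => w x * \sum_(i < n) \sum_(j < m) r i j * F i j x) /\
  \int[mu]_x (w x * \sum_(i < n) \sum_(j < m) r i j * F i j x) =
  \sum_(i < n) \sum_(j < m) r i j * \int[mu]_x (w x * F i j x).
Proof.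
move=> LF; pose G i x := \sum_(j < m) r i j * (w x * F i j x).
have LG i := @L1_mem_sum _ _ _ mu m (fun j x => r i j * (w x * F i j x))
  (fun j => L1_memZ (r i j) (LF i j)).
have [L1 L2] := @L1_mem_sum _ _ _ mu n G (fun i => (LG i).1).
rewrite (_ : (fun x => w x * _) = fun x => \sum_(i < n) G i x).
  split => //; rewrite L2; apply: eq_bigr => i _; rewrite (LG i).2.
  by apply: eq_bigr => j _; rewrite RintegralZl//; exact: LF.
apply/funext => x; rewrite mulr_sumr; apply: eq_bigr => i _.
by rewrite mulr_sumr; apply: eq_bigr => j _; rewrite mulrCA.
Qed.

Lemma sum_EFin_integral n (r : nat -> R) (F : nat -> T -> R) :
  (forall j, L1_mem mu (F j)) ->
  (\sum_(j < n) (r j)%:E * \int[mu]_x (F j x)%:E)%E =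
  (\sum_(j < n) r j * \int[mu]_x F j x)%:E.
Proof.
move=> LF; rewrite -sumEFin; apply: eq_bigr => j _; rewrite EFinM; congr (_ * _)%E.
by rewrite /Rintegral fineK//; apply: integrable_fin_num => //; exact: LF.
Qed.

Lemma L1_mem_ae (f g : T -> R) : measurable_fun setT g ->
  {ae mu, forall x, f x = g x} -> L1_mem mu f ->
  L1_mem mu g /\ \int[mu]_x f x = \int[mu]_x g x.
Proof.
move=> mg fg Lf; have [mf fi] := (L1_memP mu f).1 Lf; split.
  apply/L1_memP; split => //; apply: le_lt_trans fi.
  by apply: le_absint => //; apply: filterS fg => x ->.
rewrite /Rintegral; congr fine; apply: ae_eq_integral => //.
- exact/measurable_EFinP.
- exact/measurable_EFinP.
- by apply: filterS fg => x -> _.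
Qed.

Lemma Rintegral_le_absint (f : T -> R) : L1_mem mu f ->
  ((\int[mu]_x f x)%R%:E <= \int[mu]_x (`|f x|)%:E)%E.
Proof.
move=> Lf; apply: (@le_trans _ _ (\int[mu]_x `|f x|)%R%:E).
  rewrite lee_fin; apply: le_trans (ler_norm _) _.
  exact: le_normr_Rintegral.
rewrite /Rintegral fineK//; apply: integrable_fin_num => //.
exact: L1_mem_norm.
Qed.

End DoubleIntegrals.

Theorem theorem4p2 (R : realType)
  (d1 : measure_display) (Om : measurableType d1) (mu : {measure set Om -> \bar R})
  (d2 : measure_display) (De : measurableType d2) (nu : {measure set De -> \bar R})
  (hmu : sigma_finite setT mu) (hnu : sigma_finite setT nu)
  (X1 X2 : BFS mu) (Y1 Y2 : BFS nu)
  (sX1 : saturated mu (bfs_mem X1)) (sX2 : saturated mu (bfs_mem X2))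
  (sY1 : saturated nu (bfs_mem Y1)) (sY2 : saturated nu (bfs_mem Y2))
  (T S : (Om -> R) -> (De -> R))
  (hT : bdd_linop X1 Y1 T) (hS : bdd_linop X2 Y2 S)
  (ntT : nontrivial_op nu X1 T) (ntS : nontrivial_op nu X2 S)
  (gamma : nat -> De -> R) (beta : nat -> Om -> R)
  (hgamma : schauder_basis (kdual_mem nu (bfs_mem Y1))
                              (kdual_norm nu (bfs_mem Y1) (bfs_enorm Y1)) gamma)
  (hbeta : schauder_basis (bfs_mem X1) (bfs_enorm X1) beta)
  (sY2Y1'' : saturated nu
     (mulsp_mem (bfs_mem Y2) (kdual_mem nu (kdual_mem nu (bfs_mem Y1)))))
  (hoc : sigma_oc nu (bfs_mem Y2) (bfs_enorm Y2) \/
         sigma_oc nu (kdual_mem nu (bfs_mem Y1))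
                     (kdual_norm nu (bfs_mem Y1) (bfs_enorm Y1)))
  (h : Om -> R) (hh : mulsp_mem (bfs_mem X1) (bfs_mem X2) h) :
  let M := mulsp_mem (bfs_mem Y2) (kdual_mem nu (kdual_mem nu (bfs_mem Y1))) in
  let Sb := fun j => S (fun x => h x * beta j x) in
  let cond_a := exists g, M g /\
      forall f, bfs_mem X1 f -> {ae nu, forall y, T f y = g y * S (fun x => h x * f x) y} in
  let cond_b := exists g, M g /\
      forall n, {ae nu, forall y, T (beta n) y = g y * Sb n y} in
  let cond_c := exists C : R, 0 < C /\
      forall (n m : nat) (r : nat -> nat -> R), (forall i j, `|r i j| <= 1) ->
      (\sum_(i < n) \sum_(j < m)
          (r i j)%:E * \int[nu]_y (T (beta j) y * gamma i y)%R%:E <=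
       C%:E * pi_norm nu (bfs_mem Y2) (bfs_enorm Y2)
                (kdual_mem nu (bfs_mem Y1)) (kdual_norm nu (bfs_mem Y1) (bfs_enorm Y1))
                (fun y => (\sum_(i < n) \sum_(j < m) r i j * Sb j y * gamma i y)%R))%E in
  let cond_d := exists C : R, 0 < C /\
      forall (n m : nat) (r : nat -> R), (forall j, `|r j| <= 1) ->
      (\sum_(j < m) (r j)%:E * \int[nu]_y (T (beta j) y * gamma n y)%R%:E <=
       C%:E * \int[nu]_y (`|\sum_(j < m) r j * Sb j y * gamma n y|%R)%:E)%E in
  [/\ cond_a <-> cond_b, cond_a <-> cond_c,
      (forall f, bfs_mem Y2 f -> kdual_mem nu (kdual_mem nu (bfs_mem Y1)) f) ->
      (forall n m, n <> m -> {ae nu, forall y, gamma n y = 0 \/ gamma m y = 0}) ->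
      cond_d -> cond_a &
      (forall f, bfs_mem Y2 f -> kdual_mem nu (kdual_mem nu (bfs_mem Y1)) f) ->
      (forall n m, n <> m -> {ae nu, forall y, gamma n y = 0 \/ gamma m y = 0}) ->
      (forall g, M g <-> Linf_mem nu g) ->
      cond_d <-> cond_a].
Proof.
move=> M Sb cond_a cond_b cond_c cond_d.
have IY1 := bfs_ideal_space Y1; have IY2 := bfs_ideal_space Y2.
have IW := kdual_ideal_space IY1 hnu sY1.
have satW := kdual_saturated IY1 hnu sY1.
have hSh := bdd_linop_mulsp hS hh.
have Xbeta j : bfs_mem X1 (beta j) := hbeta.1 j.
have YT j : bfs_mem Y1 (T (beta j)) by case: hT => TY _ _ _; exact: TY.
have YS j : bfs_mem Y2 (Sb j) by case: hSh => SY _ _ _; exact: (SY (beta j)).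
have Wg i := hgamma.1 i.
have mg i := kdual_meas (Wg i).
have LYW y z : bfs_mem Y1 y -> kdual_mem nu (bfs_mem Y1) z ->
    L1_mem nu (fun x => y x * z x).
  by move=> Yy Wz; under eq_fun do rewrite mulrC; exact: Wz.2.
have LT i j : L1_mem nu (fun y => T (beta j) y * gamma i y) by exact: LYW.
pose t i j := \int[nu]_y (T (beta j) y * gamma i y).
have lhsE n m (r : nat -> nat -> R) :
    (\sum_(i < n) \sum_(j < m) (r i j)%:E *
      \int[nu]_y (T (beta j) y * gamma i y)%R%:E)%E =
    (\sum_(i < n) \sum_(j < m) r i j * t i j)%:E.
  rewrite -sumEFin; apply: eq_bigr => i _.
  exact: (@sum_EFin_integral _ _ _ nu m (r i)
    (fun j y => T (beta j) y * gamma i y) (LT i)).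
have LM w i j : M w -> L1_mem nu (fun y => w y * (Sb j y * gamma i y)).
  by move=> Mw; under eq_fun do rewrite mulrA; exact: (Mw.2 _ (YS j)).2.
have assoc n m (r : nat -> nat -> R) :
    (fun y => \sum_(i < n) \sum_(j < m) r i j * Sb j y * gamma i y) =
    fun y => \sum_(i < n) \sum_(j < m) r i j * (Sb j y * gamma i y).
  apply/funext => y; apply: eq_bigr => i _; apply: eq_bigr => j _.
  by rewrite mulrA.
have mS n m (r : nat -> nat -> R) : measurable_fun setT
    (fun y => \sum_(i < n) \sum_(j < m) r i j * Sb j y * gamma i y).
  apply: measurable_sum => i; apply: measurable_sum => j.
  by apply: measurable_funM => //; apply: measurable_funM => //; exact: bfs_meas.
have tM w i j : M w -> {ae nu, forall y, T (beta j) y = w y * Sb j y} ->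
    t i j = \int[nu]_y (w y * (Sb j y * gamma i y)).
  move=> Mw Tw; apply: (L1_mem_ae _ _ (LT i j)).2.
    by have [] := (L1_memP nu _).1 (LM w i j Mw).
  by apply: filterS Tw => y ->; rewrite mulrA.
have ab : cond_a -> cond_b.
  by move=> [g [Mg Tg]]; exists g; split => // n; exact: Tg.
have ba : cond_b -> cond_a.
  move=> [g [Mg Tg]]; exists g; split => // f Xf.
  exact: (factorization_on_basis hT hSh hbeta Tg Xf).
have ac : cond_a -> cond_c.
  move=> /ab[g [Mg Tg]].
  have [K K0 HK] := mulsp_kdual_bounded hnu satW IY2 IW Mg.
  exists K; split => // n m r _; rewrite lhsE.
  have [Lw Iw] := sum_sum_Rintegral n m r (fun i j => LM g i j Mg).
  have -> : \sum_(i < n) \sum_(j < m) r i j * t i j =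
      \int[nu]_y (g y * \sum_(i < n) \sum_(j < m) r i j * (Sb j y * gamma i y)).
    rewrite Iw; apply: eq_bigr => i _; apply: eq_bigr => j _.
    by rewrite (tM g).
  apply: le_trans (Rintegral_le_absint Lw) _.
  rewrite (assoc n m r); apply: (absint_le_pi_norm IY2 IW K0 Mg.1 _ HK).
  by rewrite -assoc.
have ca : cond_c -> cond_a.
  move=> [C [C0 HC]]; apply: ba.
  have [|g [mg' gL gE]] := pi_interpolation IY2 IW YS Wg (t := t) hnu sY2 satW hoc C0.
    by move=> n r r1; rewrite -lhsE; exact: HC.
  have Mg : M g.
    split => // y Yy; split.
      by apply: measurable_funM => //; exact: bfs_meas Yy.
    by move=> z Wz; under eq_fun do rewrite -mulrA; exact: gL.
  exists g; split => // n.
  (* [Y1] is contained in [Y1''], so both sides of the factorization lie in the dual of [Y1'], where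
     the basis [gamma] separates. *)
  have KT : kdual_mem nu (kdual_mem nu (bfs_mem Y1)) (T (beta n)).
    by split; [exact: bfs_meas (YT n)|move=> z Wz; exact: LYW].
  have KgS := kdual_memZ IW (-1) (Mg.2 _ (YS n)).
  have Kw := kdual_memD KT KgS.
  have w0 : {ae nu, forall y, T (beta n) y + -1 * (g y * Sb n y) = 0}.
    apply: (schauder_annihilator IW hnu satW hgamma Kw) => i.
    have -> : (fun y => (T (beta n) y + -1 * (g y * Sb n y)) * gamma i y) =
        fun y => T (beta n) y * gamma i y + -1 * (g y * (Sb n y * gamma i y)).
      by apply/funext => y; ring.
    have Lg := gL _ _ (YS n) (Wg i).
    rewrite (RintegralD measurableT (LT i n) (L1_memZ (-1) Lg)).
    by rewrite (RintegralZl _ measurableT Lg) gE /t mulN1r subrr.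
  by apply: filterS w0 => y /eqP; rewrite mulN1r subr_eq0 => /eqP.
have dc : (forall f, bfs_mem Y2 f -> kdual_mem nu (kdual_mem nu (bfs_mem Y1)) f) ->
    (forall n m, n <> m -> {ae nu, forall y, gamma n y = 0 \/ gamma m y = 0}) ->
    cond_d -> cond_c.
  move=> Y21 dis [C [C0 HC]].
  (* The inclusion of [Y2] in [Y1''] read as a statement about multipliers. It bounds the L1 norm by
     [K] times the pi-norm, whence the constant [C * K]. *)
  have M1 : M (fun=> 1).
    by split => // f Yf; under eq_fun do rewrite mul1r; exact: Y21.
  have [K K0 HK] := mulsp_kdual_bounded hnu satW IY2 IW M1.
  exists (C * K); split; first exact: mulr_gt0.
  (* Condition (d) is applied to each row. At almost every point at most one [gamma i] is nonzero,
     so the L1 norms of the rows add up to that of the full sum. *)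
  move=> n m r r1; pose H i y := \sum_(j < m) r i j * Sb j y * gamma i y.
  have LH i : L1_mem nu (H i).
    apply: (@L1_mem_sum _ _ _ nu m (fun j y => r i j * Sb j y * gamma i y) _).1.
    move=> j; have := L1_memZ (r i j) (LM _ i j M1).
    by under eq_fun do rewrite mul1r mulrA.
  have row i : \sum_(j < m) r i j * t i j <= C * \int[nu]_y `|H i y|.
    rewrite -lee_fin EFinM -(@sum_EFin_integral _ _ _ nu m (r i)
      (fun j y => T (beta j) y * gamma i y) (LT i)).
    rewrite [X in (_ <= _ * X)%E]fineK; first exact: HC.
    by apply: integrable_fin_num => //; exact: L1_mem_norm.
  rewrite lhsE; apply: (@le_trans _ _ (C * \sum_(i < n) \int[nu]_y `|H i y|)%:E).
    by rewrite lee_fin mulr_sumr; apply: ler_sum => i _; exact: row.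
  rewrite !EFinM -muleA lee_pmul2l//.
  have [LS <-] := @L1_mem_sum _ _ _ nu n (fun i y => `|H i y|)
    (fun i => L1_mem_norm (LH i)).
  apply: le_trans (Rintegral_le_absint LS) _.
  have := absint_le_pi_norm IY2 IW K0 M1.1 (mS n m r) HK.
  apply: le_trans; apply: le_absint.
  - by have [] := (L1_memP nu _).1 LS.
  - exact: measurable_funM.
  have dis' : {ae nu, forall y, forall i j, i <> j -> gamma i y = 0 \/ gamma j y = 0}.
    apply: ae_foralln => i; apply: ae_foralln => j.
    have [ij|ij] := pselect (i = j); first by apply: aeW.
    by apply: filterS (dis i j ij) => y.
  apply: filterS dis' => y gy; rewrite mul1r.
  rewrite (@sum_norm_disjoint _ n (fun i => H i y)) ?normr_id// => i j ij.
  have [g0|g0] := gy i j ij; [left|right]; apply: big1 => k _;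
    by rewrite g0 mulr0.
split; [by split|by split|by move=> Y21 dis cd; exact/ca/(dc Y21 dis)|].
move=> Y21 dis MLinf; split; first by move=> cd; exact/ca/(dc Y21 dis).
move=> /ab[g [Mg Tg]]; have [mg' [B gB]] := (MLinf g).1 Mg.
(* The essential bound [B] of the multiplier [g] carries no sign, while (d) asks for a positive
   constant. *)
have B0 : 0 < `|B| + 1 by rewrite ltr_wpDl.
exists (`|B| + 1); split => // n m r _.
rewrite (@sum_EFin_integral _ _ _ nu m r
  (fun j y => T (beta j) y * gamma n y) (LT n)).
have [Lw Iw] := @L1_mem_sum _ _ _ nu m
  (fun j y => r j * (g y * (Sb j y * gamma n y)))
  (fun j => L1_memZ (r j) (LM g n j Mg)).
have -> : \sum_(j < m) r j * \int[nu]_y (T (beta j) y * gamma n y) =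
    \int[nu]_y \sum_(j < m) r j * (g y * (Sb j y * gamma n y)).
  rewrite Iw; apply: eq_bigr => j _; rewrite -/(t n j) (tM g)//.
  by rewrite (RintegralZl _ measurableT (LM g n j Mg)).
apply: le_trans (Rintegral_le_absint Lw) _.
have mH : measurable_fun setT (fun y => \sum_(j < m) r j * Sb j y * gamma n y).
  apply: measurable_sum => j; apply: measurable_funM => //.
  by apply: measurable_funM => //; exact: bfs_meas.
rewrite -[X in (X%:E * _)%E](gtr0_norm B0) -absintZ//; apply: le_absint.
- by have [] := (L1_memP nu _).1 Lw.
- exact: measurable_funM.
apply: filterS gB => y gy.
rewrite (_ : \sum_(j < m) r j * (g y * (Sb j y * gamma n y)) =
    g y * \sum_(j < m) r j * Sb j y * gamma n y).
  rewrite !normrM ler_wpM2r// (le_trans gy)// [leRHS]gtr0_norm//.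
  by rewrite (le_trans (ler_norm _))// lerDl.
by rewrite mulr_sumr; apply: eq_bigr => j _; ring.
Qed.
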